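(* Let $(x^*,\mu_i^*,\mu_e^* )$ be (the corresponding components of) a solution of the static problem (P), and suppose $\mu^*_{il} > \lambda_l(1-p_l)$ and $\mu^*_{el} > x_l^*$ for all $l \in \mathcal{L}$. Then the online algorithm (with any parameter $\epsilon>0$) fulfills all the inelastic constraints, that is, $$\liminf_{K \rightarrow \infty} E \left[ \frac{1}{K} \sum_{k=1}^{K} I_{il}^*(a_i(k),c(k),d(k),q(k)) \right] \geq \lambda_l(1-p_l)\quad\text{for all } l\in\mathcal{L}.$$
   Context: Network. $\mathcal{L}$ is a finite set of links, with given interference constraints specifying which pairs of links may transmit simultaneously. Time is slotted and $T$ consecutive slots form a frame. In each frame $k$, $a_i(k)=(a_{il}(k))_{l\in\mathcal{L}}$ is the (nonnegative integer) vector of inelastic packet arrivals, with $a_{il}(k)$ of mean $\lambda_l$ and variance $\sigma_{il}^2$, $\Pr(a_{il}=0)>0$, $\Pr(a_{il}=1)>0$; $c(k)=(c_l(k))_{l\in\mathcal{L}}$ is the channel state, $c_l(k)\ge 0$ being the number of packets link $l$ can transmit per slot in the frame, with mean $\bar c_l$ and variance $\sigma_{cl}^2$. Both are independent across frames with the same distribution in every frame, and channels are independent of arrivals. $\Pr(a_i)$, $\Pr(c)$ denote their distributions. The channel state is known at the beginning of the frame. Inelastic packets not served in their frame are discarded; $p_l\in[0,1]$ is the maximal allowed loss probability at link $l$. $U_l$ is a concave utility function of the mean elastic arrival rate $x_l\ge 0$ per frame, and $w\in\mathbb{R}_+^{|\mathcal{L}|}$ is a given weight vector. Schedules. $\mathcal{S}(a_i,c)$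 is the set of feasible schedules $s=(s_{il,t},s_{el,t})_{l\in\mathcal{L},1\le t\le T}$, with $s_{il,t},s_{el,t}$ nonnegative integers (numbers of inelastic and elastic packets scheduled on link $l$ in slot $t$), such that in each slot any two links with $s_{il,t}+s_{el,t}>0$ do not interfere, $\sum_{t=1}^T s_{il,t}\le a_{il}$ for all $l$, and $s_{il,t}+s_{el,t}\le c_l$ for all $l,t$. Static problem (P). Maximize $\sum_{l}(U_l(x_l)+w_l\mu_{il})$ over $\mu_i(a_i,c),\mu_e(a_i,c),\mu_i,\mu_e,x,\Pr(s|a_i,c)$ subject to, for all $l\in\mathcal{L}$ and all $a_i,c$: $\mu_{il}(a_i,c)\le\sum_{s\in\mathcal{S}(a_i,c)}\sum_{t=1}^T s_{il,t}\Pr(s|a_i,c)$; $\mu_{el}(a_i,c)\le\sum_{s\in\mathcal{S}(a_i,c)}\sum_{t=1}^T s_{el,t}\Pr(s|a_i,c)$; $\mu_{il}=\sum_{a_i}\sum_c\mu_{il}(a_i,c)\Pr(c)\Pr(a_i)$; $\mu_{el}=\sum_{a_i}\sum_c\mu_{el}(a_i,c)\Pr(c)\Pr(a_i)$; $\mu_{il}\ge\lambda_l(1-p_l)$; $0\le x_l\le\mu_{el}$; $\Pr(s|a_i,c)\ge0$; $\sum_{s}\Pr(s|a_i,c)\le1$. Problem (P) is assumed to have a solution; starred quantities $x^*,\mu_i^*,\mu_e^*$ denote components of a solution. Online algorithm with parameter $\epsilon>0$ and fixed $X_{max}>\max_l x_l^*$. The state in frame $k$ is $(d(k),q(k))$,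 $d_l(k),q_l(k)\ge0$ (deficit counters and elastic queue lengths). Congestion controller: $\tilde x_l^*(k)\in\arg\max_{0\le x_l\le X_{max}}\frac1\epsilon U_l(x_l)-q_l(k)x_l$ (maximizers assumed to exist). Scheduler: $\tilde s^*(a_i(k),c(k),d(k),q(k))\in\arg\max_{s\in\mathcal{S}(a_i(k),c(k))}\sum_{l}\{[\frac1\epsilon w_l+d_l(k)]\sum_{t=1}^T s_{il,t}+q_l(k)\sum_{t=1}^T s_{el,t}\}$. Put $I_{il}^*=\sum_{t=1}^T\tilde s^*_{il,t}$ and $I_{el}^*=\sum_{t=1}^T\tilde s^*_{el,t}$ (functions of $(a_i(k),c(k),d(k),q(k))$). Updates: $d_l(k+1)=[d_l(k)+\tilde a_{il}(k)-I_{il}^*]^+$, $q_l(k+1)=[q_l(k)+\tilde a_{el}(k)-I_{el}^*]^+$, where $\alpha^+=\max\{\alpha,0\}$; $\tilde a_{il}(k)$ is, given $a_{il}(k)$, binomial with parameters $a_{il}(k)$ and $1-p_l$ (independent coin tosses); $\tilde a_{el}(k)$ is a nonnegative-integer random variable with (conditional on the state) mean $\tilde x_l^*(k)$ and variance at most a fixed constant $\sigma_e^2$, with $\Pr(\tilde a_{el}(k)=0)>0$ and $\Pr(\tilde a_{el}(k)=1)>0$. Under these assumptions $(d(k),q(k))$ is taken to be an irreducible aperiodic Markov chain. The initial state satisfies $E[V(d(1),q(1))]<\infty$ with $V(d,q)=\frac12\sum_{l}(d_l^2+q_l^2)$. *)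

(* Defs.v *)
From HB Require Import structures.
From mathcomp Require Import all_boot all_order all_algebra.
From mathcomp Require Import all_classical all_reals all_analysis.

Set Implicit Arguments.
Unset Strict Implicit.
Unset Printing Implicit Defensive.

Import Order.TTheory GRing.Theory Num.Theory.
Import numFieldNormedType.Exports.

Local Open Scope classical_set_scope.
Local Open Scope ring_scope.

Definition argmax (T : Type) (R : realType) (A : set T) (f : T -> R) : set T :=
  [set x | A x /\ forall y, A y -> f y <= f x].

(* Sum of a signed series in the extended reals, independent of the order of
   summation. It is meaningful as soon as the positive parts are summable, and
   it is then finite iff the series converges absolutely. *)
Definition series_sum (I : choiceType) (R : realType) (f : I -> \bar R) :
    \bar R :=
  (\esum_(i in [set: I]) f^\+ i - \esum_(i in [set: I]) f^\- i)%E.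

Notation pvec L := {ffun L -> nat}.

(* [s.1 (l, t)] and [s.2 (l, t)] are the numbers of inelastic and of elastic
   packets scheduled on link [l] in slot [t]. *)
Notation schedule L T :=
  ({ffun L * 'I_T -> nat} * {ffun L * 'I_T -> nat})%type.

(* A pair (d, q): deficit counters and elastic queue lengths. *)
Notation state R L := ({ffun L -> R} * {ffun L -> R})%type.

Record network (R : realType) (L : finType) := Network {
  slots : nat;                (* T *)
  interf : rel L;             (* [interf l m]: l and m may not transmit together *)
  lambda : L -> R;            (* mean and standard deviation of the arrivals *)
  sigma_i : L -> R;
  cbar : L -> R;              (* mean and standard deviation of the channels *)
  sigma_c : L -> R;
  pr_a : pvec L -> R;         (* Pr(a_i) *)
  pr_c : pvec L -> R;         (* Pr(c) *)
  loss : L -> R;              (* p *)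
  util : L -> R -> R;         (* U *)
  weight : L -> R             (* w *)
}.

Section Network.
Context (R : realType) (L : finType) (N : network R L).

Definition network_ok : Prop :=
  [/\ (0 < slots N)%N,
      (forall l, 0 <= loss N l <= 1),
      (forall l, 0 <= weight N l) &
      (forall l, convex_function (E := R^o) [set x | 0 <= x]
                   (fun x => - util N l x))].

Definition inelastic (s : schedule L (slots N)) (l : L) : nat :=
  (\sum_(t < slots N) s.1 (l, t))%N.

Definition elastic (s : schedule L (slots N)) (l : L) : nat :=
  (\sum_(t < slots N) s.2 (l, t))%N.

Definition feasible (a c : pvec L) : set (schedule L (slots N)) :=
  [set s : schedule L (slots N) | [/\ (forall t l m, l != m ->
                  (0 < s.1 (l, t) + s.2 (l, t))%N ->
                  (0 < s.1 (m, t) + s.2 (m, t))%N -> ~~ interf N l m),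
               (forall l, (inelastic s l <= a l)%N) &
               (forall l t, (s.1 (l, t) + s.2 (l, t) <= c l)%N)]].

(* Hence the sums over feasible schedules below, which are written with the
   finitely supported sum [\sum_(s \in _) _], are the intended ones. *)
Lemma finite_feasible (a c : pvec L) : finite_set (feasible a c).
Proof.
pose M := (\max_l c l)%N.
pose F := {ffun L * 'I_(slots N) -> 'I_M.+1}.
pose g (f : F * F) : schedule L (slots N) :=
  ([ffun i => nat_of_ord (f.1 i)], [ffun i => nat_of_ord (f.2 i)]).
apply: (@sub_finite_set _ _ (g @` [set: F * F])); last first.
  exact/finite_image/finite_finset.
move=> s [_ _ sc].
have leM l : (c l <= M)%N by exact: leq_bigmax.
have s1 i : (s.1 i < M.+1)%N.
  case: i => l t; rewrite ltnS (leq_trans _ (leM l))//.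
  by rewrite (leq_trans _ (sc l t))// leq_addr.
have s2 i : (s.2 i < M.+1)%N.
  case: i => l t; rewrite ltnS (leq_trans _ (leM l))//.
  by rewrite (leq_trans _ (sc l t))// leq_addl.
exists ([ffun i => Ordinal (s1 i)], [ffun i => Ordinal (s2 i)]) => //.
rewrite [RHS]surjective_pairing /g.
by congr pair; apply/ffunP => i; rewrite !ffunE.
Qed.

Record static_point := StaticPoint {
  mu_i_ac : pvec L -> pvec L -> L -> R;
  mu_e_ac : pvec L -> pvec L -> L -> R;
  mu_i : L -> R;
  mu_e : L -> R;
  rate : L -> R;                                            (* x *)
  pr_s : pvec L -> pvec L -> schedule L (slots N) -> R      (* Pr(s | a_i, c) *)
}.

Definition static_average (f : pvec L -> pvec L -> R) : \bar R :=
  series_sum (fun a => series_sum (fun c =>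
    (f a c * pr_c N c * pr_a N a)%:E)).

Record static_feasible (z : static_point) : Prop := StaticFeasible {
  sf_mu_i_ac : forall a c l, mu_i_ac z a c l <=
    \sum_(s \in feasible a c) (inelastic s l)%:R * pr_s z a c s;
  sf_mu_e_ac : forall a c l, mu_e_ac z a c l <=
    \sum_(s \in feasible a c) (elastic s l)%:R * pr_s z a c s;
  sf_mu_i : forall l,
    (mu_i z l)%:E = static_average (fun a c => mu_i_ac z a c l);
  sf_mu_e : forall l,
    (mu_e z l)%:E = static_average (fun a c => mu_e_ac z a c l);
  sf_loss : forall l, lambda N l * (1 - loss N l) <= mu_i z l;
  sf_rate : forall l, 0 <= rate z l <= mu_e z l;
  sf_pr_ge0 : forall a c s, feasible a c s -> 0 <= pr_s z a c s;
  sf_pr_le1 : forall a c, \sum_(s \in feasible a c) pr_s z a c s <= 1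
}.

Definition static_objective (z : static_point) : R :=
  \sum_l (util N l (rate z l) + weight N l * mu_i z l).

Definition static_solution : set static_point :=
  argmax [set z | static_feasible z] static_objective.

(* The controllers are functions of the state, which select one maximizer. *)
Definition congestion_controller (eps Xmax : R)
    (xt : state R L -> L -> R) : Prop :=
  forall s : state R L, (forall l, 0 <= s.1 l /\ 0 <= s.2 l) ->
  forall l, argmax [set y | 0 <= y <= Xmax]
    (fun y => eps^-1 * util N l y - s.2 l * y) (xt s l).

Definition scheduler (eps : R)
    (sched : pvec L -> pvec L -> state R L -> schedule L (slots N)) : Prop :=
  forall (a c : pvec L) (s : state R L),
  (forall l, 0 <= s.1 l /\ 0 <= s.2 l) ->
  argmax (feasible a c)
    (fun r => \sum_l ((eps^-1 * weight N l + s.1 l) * (inelastic r l)%:R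
                      + s.2 l * (elastic r l)%:R)) (sched a c s).

End Network.

(* Frames are numbered from 0: index [k] stands for the (k+1)-st frame. *)
Record processes (R : realType) (L : finType) (Omega : Type) := Processes {
  arr : nat -> Omega -> pvec L;       (* a_i(k), inelastic arrivals *)
  chan : nat -> Omega -> pvec L;      (* c(k), channel state *)
  toss : nat -> Omega -> pvec L;      (* a~_i(k), increments of the deficits *)
  earr : nat -> Omega -> pvec L;      (* a~_e(k), elastic arrivals *)
  st : nat -> Omega -> state R L      (* (d(k), q(k)) *)
}.

Section Stochastic.
Context (R : realType) (L : finType) (N : network R L).
Context (disp : measure_display) (Omega : measurableType disp).
Context (P : probability Omega R) (Z : processes R L Omega).

Local Open Scope ereal_scope.

(* All the variables are discrete (see [mc_countable] below for the state), so
   measurability is that of the level sets. *)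
Definition discrete_variables : Prop :=
  forall k, [/\ (forall u, measurable [set w | arr Z k w = u]),
                (forall u, measurable [set w | chan Z k w = u]),
                (forall u, measurable [set w | toss Z k w = u]),
                (forall u, measurable [set w | earr Z k w = u]) &
                (forall s, measurable [set w | st Z k w = s])].

(* Atom of the past at the beginning of frame [k], before the arrivals and the
   channel state of frame [k] are drawn. *)
Definition past (k : nat)
    (h : nat -> state R L * pvec L * pvec L * pvec L * pvec L)
    (s : state R L) : set Omega :=
  [set w | st Z k w = s /\ forall j, (j < k)%N ->
     (st Z j w, arr Z j w, chan Z j w, toss Z j w, earr Z j w) = h j].

Record arrivals_channels : Prop := ArrivalsChannels {
  ac_law_a : forall k u, P [set w | arr Z k w = u] = (pr_a N u)%:E;
  ac_law_c : forall k v, P [set w | chan Z k w = v] = (pr_c N v)%:E;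
  (* The arrivals and the channels of a frame are independent of each other
     and of everything that happened before, in particular across frames. *)
  ac_indep : forall k h s u v,
    P (past k h s `&` [set w | arr Z k w = u] `&` [set w | chan Z k w = v]) =
    P (past k h s) * (pr_a N u)%:E * (pr_c N v)%:E;
  ac_mean_a : forall k l, 'E_P[fun w => (arr Z k w l)%:R] = (lambda N l)%:E;
  ac_var_a : forall k l,
    variance P (fun w => (arr Z k w l)%:R)%R = (sigma_i N l ^+ 2)%:E;
  ac_mean_c : forall k l, 'E_P[fun w => (chan Z k w l)%:R] = (cbar N l)%:E;
  ac_var_c : forall k l,
    variance P (fun w => (chan Z k w l)%:R)%R = (sigma_c N l ^+ 2)%:E;
  ac_zero : forall k l, 0 < P [set w | arr Z k w l = 0%N];
  ac_one : forall k l, 0 < P [set w | arr Z k w l = 1%N]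
}.

(* Each of the arr_l(k) inelastic packets is kept with probability 1 - p_l by
   coin tosses independent of each other, of the channels and of the past. *)
Definition coin_tosses : Prop :=
  forall k h s (u v b : pvec L),
    P (past k h s `&` [set w | arr Z k w = u] `&` [set w | chan Z k w = v]
         `&` [set w | toss Z k w = b]) =
    P (past k h s `&` [set w | arr Z k w = u] `&` [set w | chan Z k w = v]) *
    (\prod_l binomial_pmf (u l) (1 - loss N l) (b l))%:E.

(* The mean and the variance are conditional on the event {st(k) = s}; both
   conditions are multiplied by the probability of that event. *)
Record elastic_arrivals (sigma_e : R) (xt : state R L -> L -> R) : Prop :=
    ElasticArrivals {
  ea_mean : forall k s l,
    \int[P]_(w in [set w | st Z k w = s]) ((earr Z k w l)%:R)%:E =
    (xt s l)%:E * P [set w | st Z k w = s];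
  ea_var : forall k s l,
    \int[P]_(w in [set w | st Z k w = s])
       (((earr Z k w l)%:R - xt s l) ^+ 2)%:E <=
    (sigma_e ^+ 2)%:E * P [set w | st Z k w = s];
  ea_zero : forall k l, 0 < P [set w | earr Z k w l = 0%N];
  ea_one : forall k l, 0 < P [set w | earr Z k w l = 1%N]
}.

Definition served_i
    (sched : pvec L -> pvec L -> state R L -> schedule L (slots N))
    (k : nat) (w : Omega) (l : L) : nat :=
  inelastic (sched (arr Z k w) (chan Z k w) (st Z k w)) l.

Definition served_e
    (sched : pvec L -> pvec L -> state R L -> schedule L (slots N))
    (k : nat) (w : Omega) (l : L) : nat :=
  elastic (sched (arr Z k w) (chan Z k w) (st Z k w)) l.

Definition queue_updates
    (sched : pvec L -> pvec L -> state R L -> schedule L (slots N)) : Prop :=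
  forall k w l,
    ((st Z k.+1 w).1 l = Num.max
       ((st Z k w).1 l + (toss Z k w l)%:R - (served_i sched k w l)%:R) 0)%R /\
    ((st Z k.+1 w).2 l = Num.max
       ((st Z k w).2 l + (earr Z k w l)%:R - (served_e sched k w l)%:R) 0)%R.

Definition lyapunov (s : state R L) : R :=
  (2^-1 * \sum_l (s.1 l ^+ 2 + s.2 l ^+ 2))%R.

End Stochastic.

Section MarkovChain.
Context (R : realType) (disp : measure_display) (Omega : measurableType disp).
Context (P : probability Omega R) (E : choiceType) (X : nat -> Omega -> E).

Local Open Scope ereal_scope.

Record markov_chain (S : set E) (K : E -> E -> R) : Prop := MarkovChain {
  mc_countable : countable S;
  mc_in : forall k w, S (X k w);
  mc_ge0 : forall x y, S x -> S y -> (0 <= K x y)%R;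
  mc_sum1 : forall x, S x -> \esum_(y in S) (K x y)%:E = 1;
  mc_step : forall k (x : nat -> E), (forall j, S (x j)) ->
    P [set w | forall j, (j <= k.+1)%N -> X j w = x j] =
    P [set w | forall j, (j <= k)%N -> X j w = x j] * (K (x k) (x k.+1))%:E
}.

Fixpoint nstep (S : set E) (K : E -> E -> R) (n : nat) (x y : E) : \bar R :=
  if n is m.+1 then \esum_(z in S) ((K x z)%:E * nstep S K m z y)
  else ((x == y)%:R)%:E.

Definition irreducible (S : set E) (K : E -> E -> R) : Prop :=
  forall x y, S x -> S y -> exists n, 0 < nstep S K n x y.

Definition aperiodic (S : set E) (K : E -> E -> R) : Prop :=
  forall x, S x -> forall g : nat,
    (forall n, (0 < n)%N -> 0 < nstep S K n x x -> (g %| n)%N) -> g = 1%N.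

End MarkovChain.

(* Main.v *)
Require Import Defs.
From mathcomp Require Import all_boot all_order all_algebra.
From mathcomp Require Import all_classical all_reals all_analysis.
From mathcomp Require Import measurable_realfun ring lra.

Set Implicit Arguments.
Unset Strict Implicit.
Unset Printing Implicit Defensive.

Import Order.TTheory GRing.Theory Num.Theory.
Import numFieldNormedType.Exports.

Local Open Scope classical_set_scope.
Local Open Scope ring_scope.

(** No conditional expectation is formed. All variables are discrete, so a statement given the state
    is an identity or inequality between integrals over a level set [{st Z k = s}], with the
    probability of that set as a factor; null level sets then need no care, and summing over the
    countable [S] gives back the full mean. The independence hypotheses, however, speak of atoms of
    the whole past, so the past has to be summed out until only the current state remains.

    The other obstacle is integrability: whether E V(k+1) is finite is known only after the drift
    bound, and the drift contains products of the state with arrivals and service. Every inequality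
    is therefore kept additive between nonnegative terms, with service on the left and arrivals on
    the right, so that integrals split unconditionally. A term is cancelled only on a single level
    set, where the state is constant and the term is finite.

    The static solution enters through upper bounds on its [mu_i] and [mu_e] by mean services,
    multiplied by nonnegative weights; this is compatible with signed [mu_i_ac], [mu_e_ac] and with
    a total mass of Pr(s | a_i, c) below 1. *)

(* Only the expected one-frame increase of the Lyapunov function
   V(d, q) = (|d|^2 + |q|^2) / 2 matters. The scheduler maximizes the weighted
   service at every realization, so on average it does at least as well as the
   randomized static policy Pr(s | a_i, c), whose mean service dominates the
   mean arrivals; the congestion controller changes this only by a bounded
   utility gap. Hence E V grows by at most a constant B per frame, so that
   E V(n) <= E V(0) + n B. As d <= g V + 1 / (2 g) for every g > 0, the mean
   deficit satisfies E d_l(n) = o(n). Finally d_l(n) is at least the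
   accumulated a~_i minus the accumulated inelastic service, and dividing by
   [n] gives the claim. *)

(** * Integration over the fibers of a discrete variable *)

Section DiscreteVariables.
Context (R : realType) (disp : measure_display) (Omega : measurableType disp).
Local Open Scope ereal_scope.

(** Countability is carried by a set [C] of values and not by the type [T]: states are vectors of
    reals, and only the state space [S] of the chain is countable. *)
Definition discrete_in (T : choiceType) (C : set T) (X : Omega -> T) : Prop :=
  [/\ countable C, forall w, C (X w) &
      forall x, measurable [set w | X w = x]].

Lemma discrete_in_pair (T U : choiceType) (C : set T) (D : set U) X Y :
  discrete_in C X -> discrete_in D Y ->
  discrete_in (C `*` D) (fun w => (X w, Y w)).
Proof.
move=> [cC CX mX] [cD DY mY]; split=> [|w|[x y]].
- exact: countableX.
- by split=> /=.
- rewrite [X in measurable X](_ : _ = [set w | X w = x] `&` [set w | Y w = y]).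
    exact: measurableI.
  by apply/seteqP; split=> w /= [-> ->].
Qed.

(** An injection of [C] into the naturals cuts the event into countably many pieces, each of them
    empty or a single level set. As [A] is arbitrary, every function of [X] becomes measurable. *)
Lemma discrete_measurable_set (T : choiceType) (C : set T) X (A : set T) :
  discrete_in C X -> measurable [set w | A (X w)].
Proof.
move=> [/countable_injP[f injf] CX mX].
rewrite (_ : [set w | A (X w)] =
    \bigcup_n [set w | A (X w) /\ f (X w) = n]); last first.
  by apply/seteqP; split=> [w Aw|w [n _ []]//]; exists (f (X w)).
apply: bigcupT_measurable => n.
have [[w0 [Aw0 w0n]]|no] := pselect (exists w, A (X w) /\ f (X w) = n).
  rewrite [X in measurable X](_ : _ = [set w | X w = X w0])//.
  apply/seteqP; split=> w /= => [[Aw wn]|->//].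
  by apply: injf; rewrite ?inE// w0n.
rewrite [X in measurable X](_ : _ = set0)//.
by apply/seteqP; split=> w //= Aw; apply: no; exists w.
Qed.

Lemma discrete_measurable_fun d' (U : measurableType d') (T : choiceType)
    (C : set T) X (f : T -> U) (D : set Omega) :
  discrete_in C X -> measurable_fun D (fun w => f (X w)).
Proof.
move=> dX mD Y mY; apply: measurableI => //.
exact: (discrete_measurable_set (f @^-1` Y) dX).
Qed.

Lemma integral_fibers (mu : {measure set Omega -> \bar R}) (T : choiceType)
    (C : set T) X (f : Omega -> \bar R) (D : set Omega) :
  discrete_in C X -> measurable D -> measurable_fun D f ->
  (forall w, D w -> 0 <= f w) ->
  \int[mu]_(w in D) f w =
  \esum_(x in C) \int[mu]_(w in D `&` [set w | X w = x]) f w.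
Proof.
move=> dX mD mf f0; have [/countable_injP[g injg] CX mX] := dX.
pose F n := D `&` [set w | g (X w) = n].
have DF : D = \bigcup_n F n.
  by apply/seteqP; split=> [w Dw|w [n _ []]//]; exists (g (X w)).
have mF n : measurable (F n).
  by apply: measurableI => //; exact: (discrete_measurable_set [set x | g x = n] dX).
rewrite {1}DF ge0_integral_bigcup//; first last.
- by move=> i j _ _ [w [[_ /= <-] [_ /= <-]]].
- by rewrite -DF.
- by rewrite -DF.
have FD n w : F n w -> 0 <= f w by move=> [Dw _]; exact: f0.
rewrite nneseries_esumT; last by move=> n; apply: integral_ge0; exact: FD.
(* Indices outside the image of [C] have an empty fiber, so the series over the naturals can be
   reindexed by [C]. *)
transitivity (\esum_(n in g @` C) \int[mu]_(w in F n) f w).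
  rewrite [RHS]esum_mkcond; apply: eq_esum => n _.
  case: ifPn => //; rewrite notin_setE => Cn.
  rewrite (_ : F n = set0) ?integral_set0//.
  by apply/seteqP; split=> w //= [_ /= wn]; apply: Cn; exists (X w).
rewrite esum_image; last exact: injg.
apply: eq_esum => x Cx; congr (\int[mu]_(w in _) _).
apply/seteqP; split=> w [Dw /= e]; split=> //=; last by rewrite e.
by apply: injg; rewrite ?inE.
Qed.

Lemma measure_fibers (mu : {measure set Omega -> \bar R}) (T : choiceType)
    (C : set T) X (D : set Omega) :
  discrete_in C X -> measurable D ->
  mu D = \esum_(x in C) mu (D `&` [set w | X w = x]).
Proof.
move=> dX mD; have [_ _ mX] := dX.
rewrite -[LHS]mul1e -integral_cst// (integral_fibers mu dX)//.
by apply: eq_esum => x _; rewrite integral_cst ?mul1e//; exact: measurableI.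
Qed.

(** Stands in for the tower property: conditional means given [X] are compared level set by level
    set, without dividing by probabilities. *)
Lemma le_integral_fibers (mu : {measure set Omega -> \bar R}) (T : choiceType)
    (C : set T) X (f g : Omega -> \bar R) (D : set Omega) :
  discrete_in C X -> measurable D ->
  measurable_fun D f -> measurable_fun D g ->
  (forall w, D w -> 0 <= f w) -> (forall w, D w -> 0 <= g w) ->
  (forall x, C x ->
    \int[mu]_(w in D `&` [set w | X w = x]) f w <=
    \int[mu]_(w in D `&` [set w | X w = x]) g w) ->
  \int[mu]_(w in D) f w <= \int[mu]_(w in D) g w.
Proof.
move=> dX mD mf mg f0 g0 fg.
by rewrite !(integral_fibers mu dX)//; exact: le_esum.
Qed.

Lemma eq_integral_fibers (mu : {measure set Omega -> \bar R}) (T : choiceType)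
    (C : set T) X (f g : Omega -> \bar R) (D : set Omega) :
  discrete_in C X -> measurable D ->
  measurable_fun D f -> measurable_fun D g ->
  (forall w, D w -> 0 <= f w) -> (forall w, D w -> 0 <= g w) ->
  (forall x, C x ->
    \int[mu]_(w in D `&` [set w | X w = x]) f w =
    \int[mu]_(w in D `&` [set w | X w = x]) g w) ->
  \int[mu]_(w in D) f w = \int[mu]_(w in D) g w.
Proof.
move=> dX mD mf mg f0 g0 fg.
by rewrite !(integral_fibers mu dX)//; exact: eq_esum.
Qed.

Lemma integral_constant (mu : {measure set Omega -> \bar R}) (D : set Omega)
    (f : Omega -> \bar R) c : measurable D -> (forall w, D w -> f w = c) ->
  \int[mu]_(w in D) f w = c * mu D.
Proof.
move=> mD fc; rewrite -integral_cst//; apply: eq_integral => w.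
by rewrite inE => /fc.
Qed.

Lemma le_esumZ (T : choiceType) (C : set T) (a : T -> \bar R) c :
  (0 <= c)%R -> (forall x, 0 <= a x) ->
  \esum_(x in C) (c%:E * a x) <= c%:E * \esum_(x in C) a x.
Proof.
move=> c0 a0; apply: ge_ereal_sup => _ [A AC <-].
rewrite -ge0_mule_fsumr//; apply: lee_wpmul2l; first by rewrite lee_fin.
by apply: ereal_sup_ubound; exists A.
Qed.

Lemma esumZ (T : choiceType) (C : set T) (a : T -> \bar R) c :
  (0 <= c)%R -> (forall x, 0 <= a x) ->
  \esum_(x in C) (c%:E * a x) = c%:E * \esum_(x in C) a x.
Proof.
rewrite le_eqVlt => /predU1P[<- a0|c0 a0].
  by rewrite mul0e esum1// => x _; rewrite mul0e.
apply/eqP; rewrite eq_le le_esumZ ?(ltW c0)//=.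
(* The reverse inequality is [le_esumZ] for the factor [c^-1] applied to the scaled family. *)
have ci : (0 <= c^-1)%R by rewrite invr_ge0 ltW.
rewrite muleC -lee_pdivlMr// muleC.
apply: le_trans (le_esumZ C ci _); last by move=> x; rewrite mule_ge0// lee_fin ltW.
by apply: le_esum => x _; rewrite muleA -EFinM mulVf ?gt_eqF// mul1e.
Qed.

End DiscreteVariables.

(** * Frames and their past *)

Section Frames.
Context (R : realType) (L : finType).
Context (disp : measure_display) (Omega : measurableType disp).
Context (P : probability Omega R) (Z : processes R L Omega).
Context (S : set (state R L)).
Context (dZ : discrete_variables Z) (cS : countable S).
Context (SZ : forall k w, S (st Z k w)).

Local Open Scope ereal_scope.

Lemma discrete_st k : discrete_in S (st Z k).
Proof. by split=> // x; have [] := dZ k. Qed.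

Lemma discrete_arr k : discrete_in [set: pvec L] (arr Z k).
Proof. by split=> // [|x]; [exact: countableP|have [] := dZ k]. Qed.

Lemma discrete_chan k : discrete_in [set: pvec L] (chan Z k).
Proof. by split=> // [|x]; [exact: countableP|have [] := dZ k]. Qed.

Lemma discrete_toss k : discrete_in [set: pvec L] (toss Z k).
Proof. by split=> // [|x]; [exact: countableP|have [] := dZ k]. Qed.

Lemma discrete_earr k : discrete_in [set: pvec L] (earr Z k).
Proof. by split=> // [|x]; [exact: countableP|have [] := dZ k]. Qed.

Definition frame k w :=
  (st Z k w, arr Z k w, chan Z k w, toss Z k w, earr Z k w).

Lemma discrete_frame k :
  discrete_in (S `*` setT `*` setT `*` setT `*` setT) (frame k).
Proof.
exact: discrete_in_pair (discrete_in_pair (discrete_in_pair (discrete_in_pair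
  (discrete_st k) (discrete_arr k)) (discrete_chan k)) (discrete_toss k))
  (discrete_earr k).
Qed.

Lemma measurable_frame k (f : state R L * pvec L * pvec L * pvec L * pvec L -> \bar R) D :
  measurable_fun D (fun w => f (frame k w)).
Proof. exact: (discrete_measurable_fun f (discrete_frame k)). Qed.

(* The history is forgotten one frame at a time, so that only countably many
   atoms are summed in each step. *)
Lemma marginal_past k s (A : set Omega) c : measurable A -> (0 <= c)%R ->
  (forall h, P (past Z k h s `&` A) = P (past Z k h s) * c%:E) ->
  P ([set w | st Z k w = s] `&` A) = P [set w | st Z k w = s] * c%:E.
Proof.
move=> mA c0 PA.
pose B m (h : nat -> _) := [set w | st Z k w = s /\ forall i, (i < m)%N ->
  frame i w = h i].
have mB m h : measurable (B m h).
  rewrite (_ : B m h = [set w | st Z k w = s] `&`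
      \bigcap_(i in [set i | (i < m)%N]) [set w | frame i w = h i]); last first.
    by apply/seteqP; split=> w [].
  apply: measurableI; first by have [] := dZ k.
  by apply: bigcap_measurableType => i _; have [] := discrete_frame i.
(* [B m h] prescribes the first [m] frames only, and [n] counts the frames already summed out. For
   [m = k] it is the atom [past]; for [m = 0] it is the level set of the state, and [h] is a
   dummy. *)
suff H n : forall m h, (m + n = k)%N -> P (B m h `&` A) = P (B m h) * c%:E.
  pose u0 : pvec L := [ffun=> 0%N].
  pose h0 (i : nat) := (s, u0, u0, u0, u0).
  have B0 : B 0%N h0 = [set w | st Z k w = s].
    by apply/seteqP; split=> w //= [].
  by have := H k 0%N h0 (add0n k); rewrite B0.
elim: n => [m h|n IH m h mnk]; first by rewrite addn0 => ->; exact: PA.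
have BS x : B m h `&` [set w | frame m w = x] =
    B m.+1 (fun i => if (i == m)%N then x else h i).
  apply/seteqP; split=> [w [[sw hw] xw]|w [sw hw]].
    split=> // i; rewrite ltnS leq_eqVlt.
    by case: eqP => [->//|_ /=]; exact: hw.
  split; last by have := hw m (leqnn _); rewrite eqxx.
  split=> // i im; have := hw i (ltnW im).
  by rewrite ltn_eqF.
rewrite (measure_fibers P (discrete_frame m)); last exact: measurableI.
rewrite [in RHS](measure_fibers P (discrete_frame m))// muleC -esumZ//.
by apply: eq_esum => x _; rewrite setIAC BS muleC; apply: IH; rewrite addSnnS.
Qed.

End Frames.

(** * The mean of the binomial law *)

Section BinomialMean.
Context (R : realType).

(** Terms beyond [n] vanish with the binomial coefficient. This puts the laws of all links on one
    common range, so that vectors of tosses become functions into a finite type. *)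
Lemma sum_binomial_pmf_widen (n M : nat) (q : R) (f : nat -> R) :
  (n <= M)%N ->
  \sum_(j < M.+1) f j * binomial_pmf n q j =
  \sum_(j < n.+1) f j * binomial_pmf n q j.
Proof.
move=> nM; rewrite -(big_mkord xpredT (fun j => f j * binomial_pmf n q j)).
rewrite (big_cat_nat (n := n.+1))//= big_mkord [X in _ + X]big_nat [X in _ + X]big1 ?addr0//.
by move=> j /andP[nj _]; rewrite /binomial_pmf bin_small// mulr0n mulr0.
Qed.

Lemma sum_binomial_pmf (n : nat) (q : R) :
  \sum_(j < n.+1) binomial_pmf n q j = 1.
Proof.
have := exprDn (1 - q) q n; rewrite subrK expr1n => ->.
by apply: eq_bigr => j _; rewrite /binomial_pmf mulrC.
Qed.

(** The absorption identity (j+1) C(n+1, j+1) = (n+1) C(n, j) reduces the mean for n+1 trials to the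
    total mass for n trials. *)
Lemma binomial_pmf_mean (n : nat) (q : R) :
  \sum_(j < n.+1) j%:R * binomial_pmf n q j = n%:R * q.
Proof.
case: n => [|n]; first by rewrite big_ord1 !mul0r.
rewrite big_ord_recl mul0r add0r.
transitivity (n.+1%:R * q * \sum_(j < n.+1) binomial_pmf n q j); last first.
  by rewrite sum_binomial_pmf mulr1.
rewrite mulr_sumr; apply: eq_bigr => j _.
rewrite /binomial_pmf /= /bump /= add1n subSS exprS.
rewrite -[_ *+ 'C(n.+1, _)]mulr_natr -[_ *+ 'C(n, j)]mulr_natr.
set y := _ ^+ (n - j).
have e : j.+1%:R * 'C(n.+1, j.+1)%:R = n.+1%:R * 'C(n, j)%:R :> R.
  by rewrite -!natrM mul_bin_diag.
transitivity (j.+1%:R * 'C(n.+1, j.+1)%:R * (q * q ^+ j * y)).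
  by ring.
by rewrite e; ring.
Qed.

(** Off the box [b m <= M] some factor vanishes, so the sum is finite and factors over the links:
    every link other than [l] contributes mass 1, and [l] contributes its mean. *)
Lemma esum_prod_binomial_mean (L : finType) (u : pvec L) (q : L -> R) (l : L) :
  (forall m, 0 <= q m <= 1) ->
  (\esum_(b in [set: pvec L])
     ((b l)%:R * \prod_m binomial_pmf (u m) (q m) (b m))%:E = ((u l)%:R * q l)%:E)%E.
Proof.
move=> q01; pose M := (\max_m u m)%N.
have uM m : (u m <= M)%N by exact: leq_bigmax.
pose g (f : {ffun L -> 'I_M.+1}) : pvec L := [ffun m => nat_of_ord (f m)].
have g_inj : {in [set: {ffun L -> 'I_M.+1}] &, injective g}.
  by move=> f h _ _ /ffunP fh; apply/ffunP => m; apply/val_inj; have := fh m; rewrite !ffunE.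
transitivity (\esum_(b in g @` setT)
     ((b l)%:R * \prod_m binomial_pmf (u m) (q m) (b m))%:E)%E.
  rewrite [RHS]esum_mkcond; apply: eq_esum => b _.
  case: ifPn => //; rewrite notin_setE => nb.
  have [m Mb] : exists m, (M < b m)%N.
    apply: contrapT => /forallNP bM; apply: nb.
    have bM' m : (b m < M.+1)%N by rewrite ltnS leqNgt; apply/negP/bM.
    by exists [ffun m => Ordinal (bM' m)] => //; apply/ffunP => m; rewrite !ffunE.
  rewrite (bigD1 m)//= {1}/binomial_pmf bin_small ?mulr0n ?mul0r ?mulr0//.
  exact: leq_ltn_trans Mb.
rewrite esum_image// esum_fset; first last.
-  move=> f _; rewrite lee_fin mulr_ge0// prodr_ge0// => m _.
  exact: binomial_pmf_ge0.
- exact: finite_finset.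
rewrite (fsbigE (index_enum {ffun L -> 'I_M.+1}))//; first last.
- by move=> f; rewrite mem_index_enum.
- exact: index_enum_uniq.
under eq_bigl do rewrite in_setT.
rewrite sumEFin; congr EFin.
(* Moving [b l] into the factor of link [l] makes the summand a pure product, to which
   distributivity of products over sums applies. *)
pose F m (j : 'I_M.+1) := (if m == l then (j : nat)%:R else 1) * binomial_pmf (u m) (q m) j.
transitivity (\sum_(f : {ffun L -> 'I_M.+1}) \prod_m F m (f m)).
  apply: eq_bigr => f _; rewrite big_split/= -big_mkcond big_pred1_eq ffunE.
  by congr (_ * _); apply: eq_bigr => m _; rewrite ffunE.
rewrite -bigA_distr_bigA (bigD1 l)//= [X in _ * X]big1 ?mulr1; first last.
  move=> m /negPf ml; rewrite /F; under eq_bigr do rewrite ml.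
  rewrite (sum_binomial_pmf_widen (q m) (fun=> 1) (uM m)).
  by under eq_bigr do rewrite mul1r; exact: sum_binomial_pmf.
rewrite /F; under eq_bigr do rewrite eqxx.
by rewrite (sum_binomial_pmf_widen (q l) (fun j => j%:R) (uM l)) binomial_pmf_mean.
Qed.

End BinomialMean.

(** * Arrivals, channels and tosses given the state *)

Lemma integral_fun_fibers (R : realType) (disp : measure_display)
    (Omega : measurableType disp) (mu : {measure set Omega -> \bar R})
    (T : choiceType) (C : set T) X (f : T -> \bar R) (D : set Omega) :
  discrete_in C X -> measurable D -> (forall x, 0 <= f x)%E ->
  (\int[mu]_(w in D) f (X w) =
   \esum_(x in C) (f x * mu (D `&` [set w | X w = x])))%E.
Proof.
move=> dX mD f0; rewrite (integral_fibers mu dX)//; last first.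
  exact: discrete_measurable_fun dX.
apply: eq_esum => x _; apply: integral_constant; last by move=> w [_ /= ->].
by apply: measurableI => //; case: dX.
Qed.

Section Independence.
Context (R : realType) (L : finType) (N : network R L).
Context (disp : measure_display) (Omega : measurableType disp).
Context (P : probability Omega R) (Z : processes R L Omega).
Context (S : set (state R L)).
Context (dZ : discrete_variables Z) (cS : countable S).
Context (SZ : forall k w, S (st Z k w)).
Context (ac : arrivals_channels N P Z).

Local Open Scope ereal_scope.

Lemma pr_a_ge0 u : (0 <= pr_a N u)%R.
Proof. by rewrite -lee_fin -(ac_law_a ac 0). Qed.

Lemma pr_c_ge0 v : (0 <= pr_c N v)%R.
Proof. by rewrite -lee_fin -(ac_law_c ac 0). Qed.

Lemma sum_pr_c : \esum_(v in [set: pvec L]) (pr_c N v)%:E = 1.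
Proof.
rewrite -(probability_setT P) (measure_fibers P (discrete_chan dZ 0))//.
by apply: eq_esum => v _; rewrite setTI -(ac_law_c ac 0).
Qed.

Lemma st_arr_chan k s u v :
  P ([set w | st Z k w = s] `&` [set w | arr Z k w = u] `&` [set w | chan Z k w = v]) =
  P [set w | st Z k w = s] * (pr_a N u * pr_c N v)%:E.
Proof.
have [_ ma mc _ _] : [/\ True, measurable [set w | arr Z k w = u],
    measurable [set w | chan Z k w = v], True & True] by have [] := dZ k.
rewrite -setIA; apply: (marginal_past dZ cS SZ).
- exact: measurableI.
- by rewrite mulr_ge0 ?pr_a_ge0 ?pr_c_ge0.
- by move=> h; rewrite setIA (ac_indep ac) EFinM muleA.
Qed.

Lemma st_arr k s u :
  P ([set w | st Z k w = s] `&` [set w | arr Z k w = u]) =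
  P [set w | st Z k w = s] * (pr_a N u)%:E.
Proof.
have [ms ma] : measurable [set w | st Z k w = s] /\ measurable [set w | arr Z k w = u].
  by have [] := dZ k.
rewrite (measure_fibers P (discrete_chan dZ k)); last exact: measurableI.
have fP : P [set w | st Z k w = s] \is a fin_num by exact: fin_num_measure.
transitivity (\esum_(v in [set: pvec L])
   ((fine (P [set w | st Z k w = s]) * pr_a N u)%:E * (pr_c N v)%:E)).
  apply: eq_esum => v _.
  by rewrite [LHS]st_arr_chan EFinM (EFinM (fine _)) fineK// muleA.
rewrite esumZ ?sum_pr_c ?mule1 ?EFinM ?fineK//.
- by rewrite mulr_ge0 ?pr_a_ge0// fine_ge0.
- by move=> v; rewrite lee_fin pr_c_ge0.
Qed.

Lemma integral_st_arr k s (f : pvec L -> R) : (forall u, 0 <= f u)%R ->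
  \int[P]_(w in [set w | st Z k w = s]) (f (arr Z k w))%:E =
  P [set w | st Z k w = s] * \int[P]_w (f (arr Z k w))%:E.
Proof.
move=> f0; have ms : measurable [set w | st Z k w = s] by have [] := dZ k.
have fP : P [set w | st Z k w = s] \is a fin_num by exact: fin_num_measure.
rewrite !(integral_fun_fibers P (f := fun u => (f u)%:E) (discrete_arr dZ k))//.
rewrite -[X in X * _](fineK fP) -esumZ; last 2 first.
- exact/fine_ge0/measure_ge0.
- by move=> u; rewrite mule_ge0 ?lee_fin ?measure_ge0.
apply: eq_esum => u _.
by rewrite setTI fineK// muleCA; congr (_ * _); rewrite [LHS]st_arr -(ac_law_a ac k).
Qed.

(** The right-hand side nests its sums and orders its factors as [static_average] does, which
    prepares the comparison of the scheduler with the static policy. *)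
Lemma integral_st_arr_chan k s (f : pvec L -> pvec L -> R) :
  (forall u v, 0 <= f u v)%R ->
  \int[P]_(w in [set w | st Z k w = s]) (f (arr Z k w) (chan Z k w))%:E =
  P [set w | st Z k w = s] *
  \esum_(u in [set: pvec L]) \esum_(v in [set: pvec L])
    (f u v * pr_c N v * pr_a N u)%:E.
Proof.
move=> f0; have ms : measurable [set w | st Z k w = s] by have [] := dZ k.
have fP : P [set w | st Z k w = s] \is a fin_num by exact: fin_num_measure.
have nn u v : 0 <= (f u v * pr_c N v * pr_a N u)%:E.
  by rewrite lee_fin !mulr_ge0 ?pr_a_ge0 ?pr_c_ge0.
rewrite (integral_fibers P (discrete_arr dZ k))//; first last.
- by move=> w _; rewrite lee_fin.
- pose g (x : state R L * pvec L * pvec L * pvec L * pvec L) :=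
    (f x.1.1.1.2 x.1.1.2)%:E.
  exact: (@measurable_frame _ _ _ _ _ _ dZ cS SZ k g).
rewrite -[X in X * _](fineK fP) -esumZ; last 2 first.
- exact/fine_ge0/measure_ge0.
- by move=> u; apply: esum_ge0 => v _.
apply: eq_esum => u _.
have mu : measurable [set w | arr Z k w = u] by have [] := dZ k.
transitivity (\int[P]_(w in [set w | st Z k w = s] `&` [set w | arr Z k w = u])
    (f u (chan Z k w))%:E).
  by apply: eq_integral => w; rewrite inE => -[_ /= ->].
rewrite (integral_fun_fibers P (f := fun v => (f u v)%:E) (discrete_chan dZ k)); last 2 first.
- exact: measurableI.
- by move=> v; rewrite lee_fin.
rewrite -esumZ ?fine_ge0//; apply: eq_esum => v _.
rewrite [X in _ * X]st_arr_chan fineK// muleCA; congr (_ * _).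
by rewrite -EFinM; congr EFin; ring.
Qed.

Context (ct : coin_tosses N P Z) (loss01 : forall l, (0 <= loss N l <= 1)%R).

Let q01 l : (0 <= 1 - loss N l <= 1)%R.
Proof. by have /andP[? ?] := loss01 l; rewrite subr_ge0 gerBl; apply/andP. Qed.

Definition toss_pmf (u b : pvec L) : R :=
  \prod_l binomial_pmf (u l) (1 - loss N l) (b l).

Lemma toss_pmf_ge0 u b : (0 <= toss_pmf u b)%R.
Proof. by apply: prodr_ge0 => l _; exact: binomial_pmf_ge0. Qed.

(** The toss law is given jointly with the channel and the past. With the channel fixed, the
    probability is a constant times that of the past, so [marginal_past] applies; the channel is
    summed out afterwards. *)
Lemma st_arr_toss k s u b :
  P ([set w | st Z k w = s] `&` [set w | arr Z k w = u] `&` [set w | toss Z k w = b]) =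
  P ([set w | st Z k w = s] `&` [set w | arr Z k w = u]) * (toss_pmf u b)%:E.
Proof.
have [ma mc mt _ ms] := dZ k.
have mst : measurable ([set w | st Z k w = s] `&` [set w | arr Z k w = u]).
  by apply: measurableI; [exact: ms|exact: ma].
rewrite (measure_fibers P (discrete_chan dZ k)); last exact: measurableI.
rewrite [X in _ = X * _](measure_fibers P (discrete_chan dZ k))//.
rewrite muleC -esumZ ?toss_pmf_ge0//; apply: eq_esum => v _.
rewrite setIAC muleC.
transitivity (P [set w | st Z k w = s] * (pr_a N u * pr_c N v * toss_pmf u b)%:E).
  rewrite -!setIA; apply: (marginal_past dZ cS SZ).
  - by apply: measurableI => //; exact: measurableI.
  - by rewrite !mulr_ge0 ?toss_pmf_ge0 ?pr_a_ge0 ?pr_c_ge0.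
  - move=> h; rewrite !setIA ct (ac_indep ac) /toss_pmf.
    by rewrite (EFinM (_ * _)) (EFinM (pr_a N u)) !muleA.
by rewrite EFinM muleA; congr (_ * _); rewrite -st_arr_chan.
Qed.

End Independence.

(** * First and second moments *)

(** Integrates X^2 <= 2 (X - m)^2 + 2 m^2, whose gap is (X - 2m)^2. Unlike the expansion of the
    square, this asks for no integrability of [X], and the lost factor 2 only affects a constant. *)
Lemma le_second_moment (R : realType) (disp : measure_display)
    (Omega : measurableType disp) (mu : {measure set Omega -> \bar R})
    (D : set Omega) (X : Omega -> R) (m v : R) :
  0 <= v -> measurable D -> measurable_fun D X ->
  (\int[mu]_(w in D) ((X w - m) ^+ 2)%:E <= v%:E * mu D)%E ->
  (\int[mu]_(w in D) (X w ^+ 2)%:E <= (2 * v + 2 * m ^+ 2)%:E * mu D)%E.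
Proof.
move=> v0 mD mX vX.
have mXm : measurable_fun D (fun w => ((X w - m) ^+ 2)%:E).
  by apply/measurable_EFinP; apply: measurable_funX; exact: measurable_funB.
apply: (@le_trans _ _
    (\int[mu]_(w in D) (2%:E * ((X w - m) ^+ 2)%:E + (2 * m ^+ 2)%:E)%E)%E).
  apply: ge0_le_integral => //.
  - by move=> w _; rewrite lee_fin sqr_ge0.
  - by apply/measurable_EFinP; exact: measurable_funX.
  - by apply: emeasurable_funD => //; exact: measurable_funeM.
  - move=> w _; rewrite -EFinM -EFinD lee_fin.
    have := sqr_ge0 (X w - 2 * m); nra.
rewrite ge0_integralD//; last 3 first.
- by move=> w _; rewrite -EFinM lee_fin mulr_ge0// sqr_ge0.
- exact: measurable_funeM.
- by move=> w _; rewrite lee_fin mulr_ge0// sqr_ge0.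
rewrite ge0_integralZl//; last by move=> w _; rewrite lee_fin sqr_ge0.
rewrite integral_cst//.
have m2 : 0 <= 2 * m ^+ 2 by rewrite mulr_ge0// sqr_ge0.
rewrite [(2 * v + _)%:E]EFinD [leRHS]ge0_muleDl ?lee_fin// ?mulr_ge0//.
by apply: leeD => //; rewrite [(2 * v)%:E]EFinM -muleA; exact: lee_wpmul2l.
Qed.

Lemma le_second_moment_probability (R : realType) (disp : measure_display)
    (Omega : measurableType disp) (P : probability Omega R)
    (X : Omega -> R) (m v : R) :
  0 <= v -> measurable_fun setT X ->
  (\int[P]_w ((X w - m) ^+ 2)%:E <= v%:E)%E ->
  (\int[P]_w (X w ^+ 2)%:E <= (2 * v + 2 * m ^+ 2)%:E)%E.
Proof.
move=> v0 mX vX.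
have PT : ((P : {measure set Omega -> \bar R}) setT = 1)%E.
  exact: probability_setT.
have := @le_second_moment _ _ _ P setT X m v v0 measurableT mX.
by rewrite PT !mule1; exact.
Qed.

Section Moments.
Context (R : realType) (L : finType) (N : network R L).
Context (disp : measure_display) (Omega : measurableType disp).
Context (P : probability Omega R) (Z : processes R L Omega).
Context (S : set (state R L)).
Context (dZ : discrete_variables Z) (cS : countable S).
Context (SZ : forall k w, S (st Z k w)).
Context (ac : arrivals_channels N P Z).

Local Open Scope ereal_scope.

Lemma integral_arr k l : \int[P]_w ((arr Z k w l)%:R)%:E = (lambda N l)%:E.
Proof. by rewrite -(ac_mean_a ac k l) expectation.unlock. Qed.

Lemma lambda_ge0 l : (0 <= lambda N l)%R.
Proof.
by rewrite -lee_fin -(integral_arr 0); apply: integral_ge0 => w _; rewrite lee_fin.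
Qed.

Lemma le_integral_arr_sqr k l :
  \int[P]_w ((arr Z k w l)%:R ^+ 2)%:E <=
  (2 * sigma_i N l ^+ 2 + 2 * lambda N l ^+ 2)%:E.
Proof.
apply: le_second_moment_probability; rewrite ?sqr_ge0//.
  exact: (discrete_measurable_fun
    (fun u : pvec L => (u l)%:R : R) (discrete_arr dZ k)).
rewrite -(ac_var_a ac k l) /variance covariance.unlock.
rewrite (ac_mean_a ac) expectation.unlock le_eqVlt; apply/orP; left; apply/eqP.
by apply: eq_integral => w _; rewrite expr2.
Qed.

Lemma le_integral_chan_sqr k l :
  \int[P]_w ((chan Z k w l)%:R ^+ 2)%:E <=
  (2 * sigma_c N l ^+ 2 + 2 * cbar N l ^+ 2)%:E.
Proof.
apply: le_second_moment_probability; rewrite ?sqr_ge0//.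
  exact: (discrete_measurable_fun
    (fun u : pvec L => (u l)%:R : R) (discrete_chan dZ k)).
rewrite -(ac_var_c ac k l) /variance covariance.unlock.
rewrite (ac_mean_c ac) expectation.unlock le_eqVlt; apply/orP; left; apply/eqP.
by apply: eq_integral => w _; rewrite expr2.
Qed.

Context (ct : coin_tosses N P Z) (loss01 : forall l, (0 <= loss N l <= 1)%R).

Let q01 l : (0 <= 1 - loss N l <= 1)%R.
Proof. by have /andP[? ?] := loss01 l; rewrite subr_ge0 gerBl; apply/andP. Qed.

(** On [{arr Z k = u}] the tosses have the binomial mean [u l * (1 - loss N l)]; averaging over [u]
    uses that the arrivals are independent of the state. *)
Lemma integral_st_toss k s l :
  \int[P]_(w in [set w | st Z k w = s]) ((toss Z k w l)%:R)%:E =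
  (lambda N l * (1 - loss N l))%:E * P [set w | st Z k w = s].
Proof.
have [ma _ mt _ ms] := dZ k.
transitivity (\int[P]_(w in [set w | st Z k w = s])
    ((arr Z k w l)%:R * (1 - loss N l))%:E).
  apply: (eq_integral_fibers (discrete_arr dZ k)) => //.
  - exact: (discrete_measurable_fun
    (fun u : pvec L => ((u l)%:R)%:E : \bar R) (discrete_toss dZ k)).
  - exact: (discrete_measurable_fun
      (fun u : pvec L => ((u l)%:R * (1 - loss N l))%:E : \bar R) (discrete_arr dZ k)).
  - by move=> w _; rewrite lee_fin mulr_ge0//; case/andP: (q01 l).
  move=> u _.
  have mD : measurable ([set w | st Z k w = s] `&` [set w | arr Z k w = u]).
    by apply: measurableI; [exact: ms|exact: ma].
  have fP : P ([set w | st Z k w = s] `&` [set w | arr Z k w = u]) \is a fin_num.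
    exact: fin_num_measure.
  rewrite (integral_fun_fibers P (f := fun b : pvec L => ((b l)%:R)%:E)
    (discrete_toss dZ k))//.
  rewrite [RHS](@integral_constant _ _ _ _ _ _ ((u l)%:R * (1 - loss N l))%:E)//; last first.
    by move=> w [_ /= ->].
  rewrite -(esum_prod_binomial_mean u l q01) muleC -[X in X * _](fineK fP) -esumZ; last 2 first.
  - exact/fine_ge0/measure_ge0.
  - by move=> b; rewrite lee_fin mulr_ge0// toss_pmf_ge0.
  apply: eq_esum => b _; rewrite fineK// EFinM muleCA; congr (_ * _).
  by rewrite [LHS](st_arr_toss dZ cS SZ ac ct loss01).
rewrite (integral_st_arr dZ cS SZ ac k s (f := fun u => ((u l)%:R * (1 - loss N l))%R)); last first.
  by move=> u; rewrite mulr_ge0//; case/andP: (q01 l).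
rewrite muleC; congr (_ * _); rewrite mulrC EFinM -(integral_arr k).
transitivity (\int[P]_w ((1 - loss N l)%:E * ((arr Z k w l)%:R)%:E)).
  by apply: eq_integral => w _; rewrite -EFinM mulrC.
apply: ge0_integralZl_EFin => //; last by case/andP: (q01 l).
exact: (discrete_measurable_fun
    (fun u : pvec L => ((u l)%:R)%:E : \bar R) (discrete_arr dZ k)).
Qed.

Lemma integral_toss k l :
  \int[P]_w ((toss Z k w l)%:R)%:E = (lambda N l * (1 - loss N l))%:E.
Proof.
rewrite -[RHS]mule1 -(probability_setT P) -integral_cst//.
apply: (eq_integral_fibers (discrete_st dZ cS SZ k)) => //.
- exact: (discrete_measurable_fun
    (fun u : pvec L => ((u l)%:R)%:E : \bar R) (discrete_toss dZ k)).
- by move=> w _; rewrite lee_fin mulr_ge0 ?lambda_ge0//; case/andP: (q01 l).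
move=> s _; rewrite setTI integral_st_toss integral_cst//.
by have [] := dZ k.
Qed.

(** Tosses exceed arrivals only on null sets, since the binomial law puts no mass above [u l]. The
    domination is read off fiber by fiber; the state belongs to the fiber because [st_arr_toss]
    gives the law jointly with it. *)
Lemma le_integral_toss_sqr k l :
  \int[P]_w ((toss Z k w l)%:R ^+ 2)%:E <=
  (2 * sigma_i N l ^+ 2 + 2 * lambda N l ^+ 2)%:E.
Proof.
apply: le_trans (le_integral_arr_sqr k l).
have dX := discrete_in_pair (discrete_in_pair (discrete_st dZ cS SZ k)
  (discrete_arr dZ k)) (discrete_toss dZ k).
apply: (le_integral_fibers dX) => //.
- exact: (discrete_measurable_fun
    (fun u : pvec L => ((u l)%:R ^+ 2)%:E : \bar R) (discrete_toss dZ k)).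
- exact: (discrete_measurable_fun
    (fun u : pvec L => ((u l)%:R ^+ 2)%:E : \bar R) (discrete_arr dZ k)).
move=> [[s u] b] _; have [_ _ mX] := dX; have {mX} := mX (s, u, b).
rewrite setTI => mX.
rewrite [leLHS](@integral_constant _ _ _ _ _ _ ((b l)%:R ^+ 2)%:E)//; last by move=> w /= [_ _ ->].
rewrite [leRHS](@integral_constant _ _ _ _ _ _ ((u l)%:R ^+ 2)%:E)//; last by move=> w /= [_ -> _].
have [bu|ub] := leqP (b l) (u l).
  apply: lee_wpmul2r; first exact: measure_ge0.
  by rewrite lee_fin ler_sqr ?nnegrE// ler_nat.
suff -> : (P : {measure set Omega -> \bar R})
    [set w | (st Z k w, arr Z k w, toss Z k w) = (s, u, b)] = 0 by rewrite !mule0.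
transitivity (P ([set w | st Z k w = s] `&` [set w | arr Z k w = u] `&` [set w | toss Z k w = b])).
  congr (P _); apply/seteqP; split=> w /=; first by case=> -> -> ->.
  by move=> [[-> ->] ->].
rewrite [LHS](st_arr_toss dZ cS SZ ac ct loss01) /toss_pmf (bigD1 l)//=.
by rewrite /binomial_pmf bin_small// mulr0n mul0r mule0.
Qed.

Context (sigma_e Xmax : R) (xt : state R L -> L -> R).
Context (ea : elastic_arrivals P Z sigma_e xt).
Context (xt_bound : forall s l, S s -> (0 <= xt s l <= Xmax)%R).

(** The cap [Xmax] on the conditional mean [xt s l] makes the bound uniform in the state. *)
Lemma le_integral_earr_sqr k l :
  \int[P]_w ((earr Z k w l)%:R ^+ 2)%:E <= (2 * sigma_e ^+ 2 + 2 * Xmax ^+ 2)%:E.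
Proof.
rewrite -[leRHS]mule1 -(probability_setT P) -integral_cst//.
have me D : measurable_fun D (fun w => (earr Z k w l)%:R : R).
  exact: (discrete_measurable_fun
    (fun u : pvec L => (u l)%:R : R) (discrete_earr dZ k)).
apply: (le_integral_fibers (discrete_st dZ cS SZ k)) => //.
- exact: (discrete_measurable_fun
    (fun u : pvec L => ((u l)%:R ^+ 2)%:E : \bar R) (discrete_earr dZ k)).
- by move=> w _; rewrite lee_fin addr_ge0// mulr_ge0// sqr_ge0.
move=> s Ss; rewrite setTI.
have ms : measurable [set w | st Z k w = s] by have [] := dZ k.
rewrite integral_cst//; apply: le_trans (le_second_moment (sqr_ge0 _) ms (me _) (ea_var ea k s l)) _.
apply: lee_wpmul2r; first exact: measure_ge0.
rewrite lee_fin lerD2l ler_pM2l//; have /andP[x0 xX] := xt_bound l Ss.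
by rewrite ler_sqr ?nnegrE// (le_trans x0).
Qed.

End Moments.

(** * The scheduler against the static policy *)

Section StaticPolicy.
Context (R : realType) (L : finType) (N : network R L).
Context (pa0 : forall u, 0 <= pr_a N u) (pc0 : forall v, 0 <= pr_c N v).

(** Counterpart of [static_average] for nonnegative integrands: without the split into positive and
    negative parts it is additive and homogeneous in the extended reals. *)
Definition frame_average (f : pvec L -> pvec L -> R) : \bar R :=
  (\esum_(u in [set: pvec L]) \esum_(v in [set: pvec L])
     (f u v * pr_c N v * pr_a N u)%:E)%E.

Let term_ge0 f u v : (forall u v, 0 <= f u v) ->
  (0 <= (f u v * pr_c N v * pr_a N u)%:E)%E.
Proof. by move=> f0; rewrite lee_fin !mulr_ge0. Qed.

(** Dropping the negative part only increases the sum, and a nonnegative [g] above [f] is above the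
    positive part of [f]. *)
Lemma le_series_sum (I : choiceType) (f g : I -> \bar R) :
  (forall i, f i <= g i)%E -> (forall i, 0 <= g i)%E ->
  (series_sum f <= \esum_(i in [set: I]) g i)%E.
Proof.
move=> fg g0; rewrite /series_sum -[leRHS]sube0; apply: leeB.
  by apply: le_esum => i _; rewrite funeposE ge_max fg g0.
by apply: esum_ge0 => i _; exact: funeneg_ge0.
Qed.

Lemma le_static_average (f g : pvec L -> pvec L -> R) :
  (forall u v, f u v <= g u v) -> (forall u v, 0 <= g u v) ->
  (static_average N f <= frame_average g)%E.
Proof.
move=> fg g0; apply: le_series_sum => u; last first.
  by apply: esum_ge0 => v _; exact: term_ge0.
apply: le_series_sum => v; last exact: term_ge0.
by rewrite lee_fin; do 2!apply: ler_wpM2r => //.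
Qed.

Lemma le_frame_average (f g : pvec L -> pvec L -> R) :
  (forall u v, f u v <= g u v) -> (frame_average f <= frame_average g)%E.
Proof.
move=> fg; apply: le_esum => u _; apply: le_esum => v _.
by rewrite lee_fin; do 2!apply: ler_wpM2r => //.
Qed.

Lemma frame_averageD (f g : pvec L -> pvec L -> R) :
  (forall u v, 0 <= f u v) -> (forall u v, 0 <= g u v) ->
  (frame_average (fun u v => (f u v + g u v)%R) =
   frame_average f + frame_average g)%E.
Proof.
move=> f0 g0; rewrite /frame_average -esumD; last 2 first.
- by move=> u _; apply: esum_ge0 => v _; exact: term_ge0.
- by move=> u _; apply: esum_ge0 => v _; exact: term_ge0.
apply: eq_esum => u _; rewrite -esumD; last 2 first.
- by move=> v _; exact: term_ge0.
- by move=> v _; exact: term_ge0.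
by apply: eq_esum => v _; rewrite -EFinD !mulrDl.
Qed.

Lemma frame_averageZ (f : pvec L -> pvec L -> R) c :
  0 <= c -> (forall u v, 0 <= f u v) ->
  (frame_average (fun u v => (c * f u v)%R) = c%:E * frame_average f)%E.
Proof.
move=> c0 f0; rewrite /frame_average -esumZ//; last first.
  by move=> u; apply: esum_ge0 => v _; exact: term_ge0.
apply: eq_esum => u _; rewrite -esumZ//; last by move=> v; exact: term_ge0.
by apply: eq_esum => v _; rewrite -EFinM !mulrA.
Qed.

Context (z : static_point N) (zF : static_feasible z).

Definition static_mean (f : schedule L (slots N) -> R) (u v : pvec L) : R :=
  \sum_(r \in feasible u v) f r * pr_s z u v r.

Lemma static_mean_ge0 f u v : (forall r, 0 <= f r) -> 0 <= static_mean f u v.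
Proof.
move=> f0; apply: fsumr_ge0 => r Fr.
by rewrite mulr_ge0// (sf_pr_ge0 zF).
Qed.

Lemma static_meanE f u v : static_mean f u v =
  \sum_(r <- finmap.enum_fset (fset_set (@feasible R L N u v))) f r * pr_s z u v r.
Proof. by rewrite /static_mean fsbig_finite//; exact: finite_feasible. Qed.

(** The mass of [pr_s] may be less than 1, which is why the bound [M] must be nonnegative. *)
Lemma le_static_mean f u v M : 0 <= M ->
  (forall r, feasible u v r -> f r <= M) -> static_mean f u v <= M.
Proof.
move=> M0 fM; have := sf_pr_le1 zF u v.
rewrite static_meanE fsbig_finite; last exact: finite_feasible.
move=> pr1; apply: (@le_trans _ _
  (M * \sum_(r <- finmap.enum_fset (fset_set (@feasible R L N u v))) pr_s z u v r)); last first.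
  by rewrite ler_piMr.
rewrite mulr_sumr big_seq [leRHS]big_seq; apply: ler_sum => r.
rewrite in_fset_set; last exact: finite_feasible.
rewrite inE => Fr; apply: ler_wpM2r; [exact: (sf_pr_ge0 zF)|exact: fM].
Qed.

Context (eps : R) (eps0 : 0 < eps) (w0 : forall l, 0 <= weight N l).
Context (sched : pvec L -> pvec L -> state R L -> schedule L (slots N)).
Context (hsched : scheduler eps sched).

Definition schedule_weight (s : state R L) (r : schedule L (slots N)) : R :=
  \sum_l ((eps^-1 * weight N l + s.1 l) * (inelastic r l)%:R
          + s.2 l * (elastic r l)%:R).

Lemma schedule_weight_ge0 (s : state R L) r : (forall l, 0 <= s.1 l /\ 0 <= s.2 l) ->
  0 <= schedule_weight s r.
Proof.
move=> s0; apply: sumr_ge0 => l _; have [d0 q0] := s0 l.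
by rewrite addr_ge0 ?mulr_ge0 ?addr_ge0// ?mulr_ge0// ?invr_ge0 ltW.
Qed.

Lemma le_static_scheduler (s : state R L) : (forall l, 0 <= s.1 l /\ 0 <= s.2 l) ->
  ((\sum_l ((eps^-1 * weight N l + s.1 l) * mu_i z l + s.2 l * mu_e z l))%:E <=
   frame_average (fun u v => schedule_weight s (sched u v s)))%E.
Proof.
move=> s0.
pose a l := eps^-1 * weight N l + s.1 l.
have a0 l : 0 <= a l.
  by have [? _] := s0 l; rewrite addr_ge0 ?mulr_ge0// invr_ge0 ltW.
have q0 l : 0 <= s.2 l by have [] := s0 l.
pose mi l := static_mean (fun r => (inelastic r l)%:R).
pose me l := static_mean (fun r => (elastic r l)%:R).
have mi0 l u v : 0 <= mi l u v by exact: static_mean_ge0.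
have me0 l u v : 0 <= me l u v by exact: static_mean_ge0.
have ami0 l u v : 0 <= a l * mi l u v by rewrite mulr_ge0.
have qme0 l u v : 0 <= s.2 l * me l u v by rewrite mulr_ge0.
have le_r (r : seq L) :
  ((\sum_(l <- r) (a l * mu_i z l + s.2 l * mu_e z l))%:E <=
   frame_average (fun u v => \sum_(l <- r) (a l * mi l u v + s.2 l * me l u v))%R)%E.
  elim: r => [|l r IH].
    rewrite big_nil; apply: esum_ge0 => u _; apply: esum_ge0 => v _.
    by rewrite big_nil !mul0r.
  rewrite big_cons (_ : frame_average _ = frame_average (fun u v =>
      ((a l * mi l u v + s.2 l * me l u v) +
       \sum_(m <- r) (a m * mi m u v + s.2 m * me m u v))%R)); last first.
    by congr frame_average; apply/funext => u; apply/funext => v; rewrite big_cons.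
  rewrite frame_averageD//; first last.
  - by move=> u v; apply: sumr_ge0 => m _; rewrite addr_ge0.
  - by move=> u v; rewrite addr_ge0.
  rewrite frame_averageD// !frame_averageZ// EFinD leeD// EFinD leeD//.
    rewrite EFinM lee_wpmul2l ?lee_fin// (sf_mu_i zF).
    by apply: le_static_average => // u v; exact: (sf_mu_i_ac zF).
  rewrite EFinM lee_wpmul2l ?lee_fin// (sf_mu_e zF).
  by apply: le_static_average => // u v; exact: (sf_mu_e_ac zF).
apply: le_trans (le_r _) _; apply: le_frame_average => u v.
(* Exchanging links and schedules turns the integrand into the mean of [schedule_weight s] under
   [pr_s z u v], which cannot exceed the nonnegative maximum attained by [sched u v s]. *)
rewrite (_ : \sum_(l <- _) _ = static_mean (schedule_weight s) u v).
  apply: le_static_mean; first exact: schedule_weight_ge0.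
  by move=> r Fr; have [_] := hsched u v s0; exact.
rewrite static_meanE; under [RHS]eq_bigr do rewrite mulr_suml.
rewrite [RHS]exchange_big; apply: eq_bigr => l _ /=.
rewrite /mi /me !static_meanE !mulr_sumr -big_split; apply: eq_bigr => r _ /=.
by rewrite /a; ring.
Qed.

End StaticPolicy.

(** * Drift of the Lyapunov function *)

Lemma ge0_integralD3 (R : realType) (disp : measure_display)
    (Omega : measurableType disp) (mu : {measure set Omega -> \bar R})
    (D : set Omega) (f g h : Omega -> \bar R) : measurable D ->
  measurable_fun D f -> measurable_fun D g -> measurable_fun D h ->
  (forall w, D w -> 0 <= f w)%E -> (forall w, D w -> 0 <= g w)%E ->
  (forall w, D w -> 0 <= h w)%E ->
  (\int[mu]_(w in D) (f w + g w + h w) =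
   \int[mu]_(w in D) f w + \int[mu]_(w in D) g w + \int[mu]_(w in D) h w)%E.
Proof.
move=> mD mf mg mh f0 g0 h0.
have fg0 w : D w -> (0 <= f w + g w)%E by move=> Dw; rewrite adde_ge0 ?f0 ?g0.
have mfg : measurable_fun D (fun w => (f w + g w)%E) by exact: emeasurable_funD.
by rewrite (ge0_integralD mu mD fg0 mfg h0 mh) (ge0_integralD mu mD f0 mf g0 mg).
Qed.

(** * Calculus of upper bounds on means of nonnegative functions *)

Section MeanBound.
Context (R : realType) (disp : measure_display) (Omega : measurableType disp).
Context (mu : {measure set Omega -> \bar R}).

Definition mean_le (f : Omega -> R) (a : R) : Prop :=
  [/\ measurable_fun setT (fun w => (f w)%:E), forall w, 0 <= f w &
      (\int[mu]_w (f w)%:E <= a%:E)%E].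

Lemma mean_leD f g a b : mean_le f a -> mean_le g b ->
  mean_le (fun w => f w + g w) (a + b).
Proof.
move=> [mf f0 fa] [mg g0 gb].
split=> [|w|]; [exact: emeasurable_funD mf mg|exact: addr_ge0|].
have f0' w : setT w -> (0 <= (f w)%:E)%E by rewrite lee_fin.
have g0' w : setT w -> (0 <= (g w)%:E)%E by rewrite lee_fin.
by have := ge0_integralD mu measurableT f0' mf g0' mg => /= ->; rewrite EFinD; exact: leeD.
Qed.

Lemma mean_leZ f a c : 0 <= c -> mean_le f a ->
  mean_le (fun w => c * f w) (c * a).
Proof.
move=> c0 [mf f0 fa].
split=> [|w|]; [exact: measurable_funeM c%:E mf|exact: mulr_ge0|].
have f0' w : setT w -> (0 <= (f w)%:E)%E by rewrite lee_fin.
have := ge0_integralZl_EFin mu measurableT f0' mf c0 => /= ->.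
by rewrite EFinM; apply: lee_wpmul2l; rewrite ?lee_fin.
Qed.

Lemma mean_le_sum (I : Type) (r : seq I) (f : I -> Omega -> R) (a : I -> R) :
  (forall i, mean_le (f i) (a i)) ->
  mean_le (fun w => \sum_(i <- r) f i w) (\sum_(i <- r) a i).
Proof.
move=> fa; elim: r => [|i r IH].
  rewrite big_nil (_ : (fun w => _) = cst 0); last first.
    by apply/funext => w; rewrite big_nil.
  by split=> //=; rewrite (@integral_constant _ _ _ _ _ _ 0%E)// mul0e.
rewrite big_cons (_ : (fun w => _) = fun w => f i w + \sum_(j <- r) f j w); last first.
  by apply/funext => w; rewrite big_cons.
exact: mean_leD.
Qed.

End MeanBound.

Section Drift.
Context (R : realType) (L : finType) (N : network R L).

Lemma feasible_elastic_le (u v : pvec L) (r : schedule L (slots N)) l :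
  feasible u v r -> (elastic r l <= slots N * v l)%N.
Proof.
move=> [_ _ rv]; rewrite -[X in (_ <= X * _)%N]card_ord -sum_nat_const.
by apply: leq_sum => t _; apply: leq_trans (rv l t); exact: leq_addl.
Qed.

Lemma max0_sqr_le (x : R) : Num.max x 0 ^+ 2 <= x ^+ 2.
Proof. by case: (leP x 0) => // _; rewrite expr0n sqr_ge0. Qed.

(** Expand the square, drop -t i and replace i^2 by b^2. The service term [d * i] stays on the left
    so that both sides are nonnegative and can be integrated as they stand. *)
Lemma sqr_update_le (d t i b : R) : 0 <= d -> 0 <= t -> 0 <= i -> i <= b ->
  2^-1 * Num.max (d + t - i) 0 ^+ 2 + d * i <=
  2^-1 * d ^+ 2 + d * t + 2^-1 * (t ^+ 2 + b ^+ 2).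
Proof.
move=> d0 t0 i0 ib; have := max0_sqr_le (d + t - i).
have : i ^+ 2 <= b ^+ 2 by rewrite ler_sqr ?nnegrE// (le_trans i0).
have : 0 <= t * i by exact: mulr_ge0.
by set m := Num.max _ _ ^+ 2; nra.
Qed.

Context (disp : measure_display) (Omega : measurableType disp).
Context (P : probability Omega R) (Z : processes R L Omega).
Context (S : set (state R L)).
Context (dZ : discrete_variables Z) (cS : countable S).
Context (SZ : forall k w, S (st Z k w)).
Context (S0 : forall s, S s -> forall l, 0 <= s.1 l /\ 0 <= s.2 l).
Context (ac : arrivals_channels N P Z).
Context (ct : coin_tosses N P Z).
Context (loss01 : forall l, 0 <= loss N l <= 1) (w0 : forall l, 0 <= weight N l).
Context (eps Xmax sigma_e : R) (xt : state R L -> L -> R) (eps0 : 0 < eps).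
Context (hxt : congestion_controller N eps Xmax xt).
Context (ea : elastic_arrivals P Z sigma_e xt).
Context (sched : pvec L -> pvec L -> state R L -> schedule L (slots N)).
Context (hsched : scheduler eps sched) (hq : queue_updates Z sched).
Context (z : static_point N) (zF : static_feasible z).
Context (zX : forall l, rate z l < Xmax).

(** The part of the drift that does not multiply the state. Its last summand pays for the term
    [eps^-1 * weight N l] of the scheduler's objective, since at most the arrivals are served. *)
Definition noise (k : nat) (w : Omega) : R :=
  \sum_l (2^-1 * ((toss Z k w l)%:R ^+ 2 + (arr Z k w l)%:R ^+ 2) +
          2^-1 * ((earr Z k w l)%:R ^+ 2 + ((slots N)%:R * (chan Z k w l)%:R) ^+ 2) +
          eps^-1 * weight N l * (arr Z k w l)%:R).

Lemma noise_ge0 k w : 0 <= noise k w.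
Proof.
apply: sumr_ge0 => l _.
by rewrite !addr_ge0 ?mulr_ge0// ?addr_ge0 ?sqr_ge0// invr_ge0 ltW.
Qed.

Lemma lyapunov_pathwise k w :
  lyapunov (st Z k.+1 w) +
    schedule_weight eps (st Z k w) (sched (arr Z k w) (chan Z k w) (st Z k w)) <=
  lyapunov (st Z k w) +
    \sum_l ((st Z k w).1 l * (toss Z k w l)%:R + (st Z k w).2 l * (earr Z k w l)%:R) +
    noise k w.
Proof.
have s0 := S0 (SZ k w).
rewrite /lyapunov /schedule_weight /noise !mulr_sumr -!big_split/=.
apply: ler_sum => l _; have [-> ->] := hq k w l.
have [d0 q0] := s0 l.
have [fr _] := hsched (arr Z k w) (chan Z k w) s0.
have [_ ri _] := fr.
have ilea : (served_i Z sched k w l)%:R <= (arr Z k w l)%:R :> R.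
  by rewrite ler_nat; exact: ri.
have elec : (served_e Z sched k w l)%:R <= (slots N)%:R * (chan Z k w l)%:R :> R.
  by rewrite -natrM ler_nat; exact: feasible_elastic_le fr.
have dU := @sqr_update_le _ (toss Z k w l)%:R _ _ d0 (ler0n _ _) (ler0n _ _) ilea.
have qU := @sqr_update_le _ (earr Z k w l)%:R _ _ q0 (ler0n _ _) (ler0n _ _) elec.
have wI : eps^-1 * weight N l * (served_i Z sched k w l)%:R <=
    eps^-1 * weight N l * (arr Z k w l)%:R.
  by apply: ler_wpM2l => //; rewrite mulr_ge0// invr_ge0 ltW.
rewrite -/(served_i Z sched k w l) -/(served_e Z sched k w l).
move: dU qU wI; set m1 := Num.max _ 0 ^+ 2; set m2 := Num.max _ 0 ^+ 2.
lra.
Qed.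

Lemma rate_ge0 l : 0 <= rate z l.
Proof. by have /andP[] := sf_rate zF l. Qed.

Lemma xt_bounds s l : S s -> 0 <= xt s l <= Xmax.
Proof. by move=> Ss; have [] := hxt (S0 Ss) l. Qed.

(* With empty queues the congestion controller maximizes the utility alone. *)
Definition empty_state : state R L := ([ffun=> 0], [ffun=> 0]).

Lemma util_le_empty l y : 0 <= y <= Xmax ->
  eps^-1 * util N l y <= eps^-1 * util N l (xt empty_state l).
Proof.
move=> y01; have e0 m : 0 <= empty_state.1 m /\ 0 <= empty_state.2 m.
  by rewrite !ffunE.
have [_ /(_ y y01)] := hxt e0 l.
by rewrite ffunE !mul0r !subr0.
Qed.

(** Bounds the utility advantage of [xt s] over the static rate for all states at once, because the
    maximum of [util] over [0, Xmax] is attained at [xt empty_state]. *)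
Definition utility_gap : R :=
  \sum_l eps^-1 * (util N l (xt empty_state l) - util N l (rate z l)).

Lemma rate_in l : 0 <= rate z l <= Xmax.
Proof. by rewrite rate_ge0/= ltW. Qed.

Lemma utility_gap_ge0 : 0 <= utility_gap.
Proof.
apply: sumr_ge0 => l _; rewrite mulrBr subr_ge0.
exact/util_le_empty/rate_in.
Qed.

Definition arrival_rate (s : state R L) : R :=
  \sum_l (s.1 l * (lambda N l * (1 - loss N l)) + s.2 l * xt s l).

Definition static_rate (s : state R L) : R :=
  \sum_l ((eps^-1 * weight N l + s.1 l) * mu_i z l + s.2 l * mu_e z l).

(** Optimality of [xt s] against the static rate x gives q (xt s - x) <= (U(xt s) - U(x)) / eps,
    which the gap dominates. The rest is x <= mu_e, the loss constraint on mu_i, and nonnegativity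
    of the term with [weight]. *)
Lemma arrival_rate_le s : S s -> arrival_rate s <= static_rate s + utility_gap.
Proof.
move=> Ss; rewrite /static_rate /utility_gap -big_split/=; apply: ler_sum => l _.
have [d0 q0] := S0 Ss l.
have [_ /(_ _ (rate_in l)) xtU] := hxt (S0 Ss) l.
have Ue := util_le_empty l (xt_bounds l Ss).
have li := ler_wpM2l d0 (sf_loss zF l).
have /andP[_ re] := sf_rate zF l.
have re' := ler_wpM2l q0 re.
have mu0 : 0 <= mu_i z l.
  apply: le_trans (sf_loss zF l); rewrite mulr_ge0 ?(lambda_ge0 ac)// subr_ge0.
  by case/andP: (loss01 l).
have wm : 0 <= eps^-1 * weight N l * mu_i z l.
  by rewrite !mulr_ge0// invr_ge0 ltW.
move: xtU Ue li re' wm => /=.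
rewrite (mulrBr eps^-1) mulrDl; lra.
Qed.

Local Open Scope ereal_scope.

Lemma lyapunov_ge0 (s : state R L) : (0 <= lyapunov s)%R.
Proof.
by rewrite mulr_ge0// sumr_ge0// => l _; rewrite addr_ge0// sqr_ge0.
Qed.

Lemma measurable_noise k D : measurable_fun D (fun w => (noise k w)%:E).
Proof.
exact: (@measurable_frame _ _ _ _ _ _ dZ cS SZ k (fun x => (\sum_l
  (2^-1 * ((x.1.2 l)%:R ^+ 2 + (x.1.1.1.2 l)%:R ^+ 2) +
   2^-1 * ((x.2 l)%:R ^+ 2 + ((slots N)%:R * (x.1.1.2 l)%:R) ^+ 2) +
   eps^-1 * weight N l * (x.1.1.1.2 l)%:R))%R%:E)).
Qed.

Lemma integral_st_arrivals k s : S s ->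
  \int[P]_(w in [set w | st Z k w = s])
    (\sum_l (s.1 l * (toss Z k w l)%:R + s.2 l * (earr Z k w l)%:R))%:E =
  (arrival_rate s)%:E * P [set w | st Z k w = s].
Proof.
move=> Ss; have ms : measurable [set w | st Z k w = s] by have [] := dZ k.
have mt l D : measurable_fun D (fun w => ((toss Z k w l)%:R)%:E : \bar R).
  exact: (discrete_measurable_fun
    (fun u : pvec L => ((u l)%:R)%:E : \bar R) (discrete_toss dZ k)).
have me l D : measurable_fun D (fun w => ((earr Z k w l)%:R)%:E : \bar R).
  exact: (discrete_measurable_fun
    (fun u : pvec L => ((u l)%:R)%:E : \bar R) (discrete_earr dZ k)).
have fP : P [set w | st Z k w = s] \is a fin_num by exact: fin_num_measure.
transitivity (\sum_l \int[P]_(w in [set w | st Z k w = s])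
    ((s.1 l)%:E * ((toss Z k w l)%:R)%:E + (s.2 l)%:E * ((earr Z k w l)%:R)%:E)).
  rewrite -ge0_integral_sum//.
  - by apply: eq_integral => w _; rewrite -sumEFin.
  - by move=> l; apply: emeasurable_funD; exact: measurable_funeM.
  - move=> l w _; have [d0 q0] := S0 Ss l.
    by rewrite adde_ge0// -EFinM lee_fin mulr_ge0.
rewrite -(fineK fP) -EFinM /arrival_rate mulr_suml -sumEFin; apply: eq_bigr => l _.
have [d0 q0] := S0 Ss l.
rewrite ge0_integralD//; last 4 first.
- by move=> w _; rewrite -EFinM lee_fin mulr_ge0.
- exact: measurable_funeM.
- by move=> w _; rewrite -EFinM lee_fin mulr_ge0.
- exact: measurable_funeM.
rewrite !ge0_integralZl_EFin//.
rewrite (integral_st_toss dZ cS SZ ac ct loss01) (ea_mean ea) -(fineK fP).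
by rewrite -!EFinM -EFinD mulrDl !mulrA.
Qed.

Lemma le_integral_st_scheduler k s : S s ->
  (static_rate s)%:E * P [set w | st Z k w = s] <=
  \int[P]_(w in [set w | st Z k w = s])
    (schedule_weight eps s (sched (arr Z k w) (chan Z k w) s))%:E.
Proof.
move=> Ss.
rewrite (integral_st_arr_chan dZ cS SZ ac k s
  (f := fun u v => schedule_weight eps s (sched u v s))); last first.
  by move=> u v; exact: (schedule_weight_ge0 eps0 w0 _ (S0 Ss)).
rewrite muleC; apply: lee_wpmul2l; first exact: measure_ge0.
exact: (le_static_scheduler (pr_a_ge0 ac) (pr_c_ge0 ac) zF eps0 w0 hsched (S0 Ss)).
Qed.

Lemma le_integral_st_lyapunov k s : S s ->
  \int[P]_(w in [set w | st Z k w = s]) (lyapunov (st Z k.+1 w))%:E <=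
  \int[P]_(w in [set w | st Z k w = s])
    ((lyapunov (st Z k w))%:E + utility_gap%:E + (noise k w)%:E).
Proof.
move=> Ss; have ms : measurable [set w | st Z k w = s] by have [] := dZ k.
have fP : P [set w | st Z k w = s] \is a fin_num by exact: fin_num_measure.
set D := [set w | st Z k w = s].
have mV n : measurable_fun D (fun w => (lyapunov (st Z n w))%:E).
  exact: (discrete_measurable_fun (fun s => (lyapunov s)%:E) (discrete_st dZ cS SZ n)).
have mF : measurable_fun D (fun w =>
    (schedule_weight eps s (sched (arr Z k w) (chan Z k w) s))%:E).
  exact: (@measurable_frame _ _ _ _ _ _ dZ cS SZ k
    (fun x => (schedule_weight eps s (sched x.1.1.1.2 x.1.1.2 s))%:E)).
have mT : measurable_fun D (fun w =>
    (\sum_l (s.1 l * (toss Z k w l)%:R + s.2 l * (earr Z k w l)%:R))%:E).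
  exact: (@measurable_frame _ _ _ _ _ _ dZ cS SZ k
    (fun x => (\sum_l (s.1 l * (x.1.2 l)%:R + s.2 l * (x.2 l)%:R))%:E)).
have s0 := S0 Ss.
have F0 w : D w -> 0 <= (schedule_weight eps s (sched (arr Z k w) (chan Z k w) s))%:E.
  by move=> _; rewrite lee_fin; exact: (schedule_weight_ge0 eps0 w0 _ s0).
have T0 w : D w ->
    0 <= (\sum_l (s.1 l * (toss Z k w l)%:R + s.2 l * (earr Z k w l)%:R))%:E.
  move=> _; rewrite lee_fin sumr_ge0// => l _; have [d0 q0] := s0 l.
  by rewrite addr_ge0 ?mulr_ge0.
have V0 n w : D w -> 0 <= (lyapunov (st Z n w))%:E.
  by move=> _; rewrite lee_fin lyapunov_ge0.
have N0 w : D w -> 0 <= (noise k w)%:E by move=> _; rewrite lee_fin noise_ge0.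
have mN := @measurable_noise k D.
have arrE := integral_st_arrivals k Ss; rewrite -/D in arrE.
have VE : \int[P]_(w in D) (lyapunov s)%:E = (lyapunov s)%:E * P D.
  exact: integral_cst.
have step : \int[P]_(w in D) (lyapunov (st Z k.+1 w))%:E + (static_rate s)%:E * P D <=
    (lyapunov s)%:E * P D + (arrival_rate s)%:E * P D + \int[P]_(w in D) (noise k w)%:E.
  apply: le_trans (leeD (lexx _) (le_integral_st_scheduler k Ss)) _.
  rewrite -/D -arrE -VE -ge0_integralD3//; last first.
    by move=> w _; rewrite lee_fin lyapunov_ge0.
  rewrite -(ge0_integralD P (D := D) ms (@V0 k.+1) (mV k.+1) F0 mF).
  apply: ge0_le_integral => //.
  - by move=> w Dw; rewrite adde_ge0 ?F0 ?V0.
  - exact: emeasurable_funD.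
  - by apply: emeasurable_funD => //; exact: emeasurable_funD.
  - move=> w sw; rewrite -!EFinD lee_fin.
    by have := lyapunov_pathwise k w; rewrite sw.
rewrite ge0_integralD3//; [|exact: V0|by move=> w _; rewrite lee_fin utility_gap_ge0].
rewrite integral_cst// (@integral_constant _ _ _ _ _ _ (lyapunov s)%:E)//; last by move=> w ->.
(* The static rate can be added on both sides because on this level set it is a finite constant
   times a probability. *)
rewrite -(@leeD2rE _ ((static_rate s)%:E * P D)) ?fin_numM//.
apply: le_trans step _.
rewrite [leRHS]addeAC; apply: leeD => //; rewrite -addeA; apply: leeD => //.
have PD : P D = (fine (P D))%:E by rewrite fineK.
have PD' : (P : {measure set Omega -> \bar R}) D = (fine (P D))%:E := PD.
rewrite PD' PD -!EFinM -EFinD lee_fin -mulrDl; apply: ler_wpM2r.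
  exact/fine_ge0/measure_ge0.
by rewrite addrC; exact: arrival_rate_le.
Qed.

(** Term by term the mean of [noise]: tosses and arrivals share one second-moment bound, whence the
    doubling, and the elastic service is at most [slots N] times the channel, whence the squared
    factor. *)
Definition step_bound : R :=
  utility_gap + \sum_l
    (2^-1 * ((2 * sigma_i N l ^+ 2 + 2 * lambda N l ^+ 2) *+ 2) +
     2^-1 * ((2 * sigma_e ^+ 2 + 2 * Xmax ^+ 2) +
             (slots N)%:R ^+ 2 * (2 * sigma_c N l ^+ 2 + 2 * cbar N l ^+ 2)) +
     eps^-1 * weight N l * lambda N l).

Lemma le_integral_noise k :
  utility_gap%:E + \int[P]_w (noise k w)%:E <= step_bound%:E.
Proof.
rewrite EFinD leeD2l//.
have arr_le l : mean_le P (fun w => (arr Z k w l)%:R ^+ 2)%R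
    (2 * sigma_i N l ^+ 2 + 2 * lambda N l ^+ 2)%R.
  split=> [|w|]; [|exact: sqr_ge0|exact: (le_integral_arr_sqr dZ ac)].
  exact: (discrete_measurable_fun
    (fun u : pvec L => ((u l)%:R ^+ 2)%:E : \bar R) (discrete_arr dZ k)).
have toss_le l : mean_le P (fun w => (toss Z k w l)%:R ^+ 2)%R
    (2 * sigma_i N l ^+ 2 + 2 * lambda N l ^+ 2)%R.
  split=> [|w|]; [|exact: sqr_ge0|exact: (le_integral_toss_sqr dZ cS SZ ac ct loss01)].
  exact: (discrete_measurable_fun
    (fun u : pvec L => ((u l)%:R ^+ 2)%:E : \bar R) (discrete_toss dZ k)).
have chan_le l : mean_le P (fun w => (chan Z k w l)%:R ^+ 2)%R
    (2 * sigma_c N l ^+ 2 + 2 * cbar N l ^+ 2)%R.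
  split=> [|w|]; [|exact: sqr_ge0|exact: (le_integral_chan_sqr dZ ac)].
  exact: (discrete_measurable_fun
    (fun u : pvec L => ((u l)%:R ^+ 2)%:E : \bar R) (discrete_chan dZ k)).
have earr_le l : mean_le P (fun w => (earr Z k w l)%:R ^+ 2)%R
    (2 * sigma_e ^+ 2 + 2 * Xmax ^+ 2)%R.
  split=> [|w|]; [|exact: sqr_ge0|].
    exact: (discrete_measurable_fun
    (fun u : pvec L => ((u l)%:R ^+ 2)%:E : \bar R) (discrete_earr dZ k)).
  by apply: (le_integral_earr_sqr dZ cS SZ ea) => s m; exact: xt_bounds.
have arr1_le l : mean_le P (fun w => (arr Z k w l)%:R)%R (lambda N l).
  split=> [|w|]; [|exact: ler0n|by rewrite (integral_arr ac)].
  exact: (discrete_measurable_fun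
    (fun u : pvec L => ((u l)%:R)%:E : \bar R) (discrete_arr dZ k)).
suff [_ _] : mean_le P (noise k) (step_bound - utility_gap)%R.
  by rewrite /step_bound addrC addKr.
rewrite /step_bound addrC addKr; apply: mean_le_sum => l.
apply: mean_leD; first apply: mean_leD.
- apply: mean_leZ; first by rewrite invr_ge0.
  by rewrite mulr2n; exact: mean_leD.
- apply: mean_leZ; first by rewrite invr_ge0.
  apply: mean_leD => //.
  rewrite (_ : (fun w => _) = fun w => (slots N)%:R ^+ 2 * (chan Z k w l)%:R ^+ 2)%R.
    by apply: mean_leZ => //; exact: sqr_ge0.
  by apply/funext => w; rewrite exprMn.
- by apply: mean_leZ => //; rewrite mulr_ge0// invr_ge0 ltW.
Qed.

Lemma le_integral_lyapunov k :
  \int[P]_w (lyapunov (st Z k.+1 w))%:E <=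
  \int[P]_w (lyapunov (st Z k w))%:E + step_bound%:E.
Proof.
have mV n : measurable_fun setT (fun w => (lyapunov (st Z n w))%:E).
  exact: (discrete_measurable_fun (fun s => (lyapunov s)%:E) (discrete_st dZ cS SZ n)).
have mN := @measurable_noise k setT.
apply: (@le_trans _ _ (\int[P]_w
    ((lyapunov (st Z k w))%:E + utility_gap%:E + (noise k w)%:E))).
  apply: (le_integral_fibers (discrete_st dZ cS SZ k)) => //.
  - by apply: emeasurable_funD => //; exact: emeasurable_funD.
  - by move=> w _; rewrite lee_fin lyapunov_ge0.
  - by move=> w _; rewrite -!EFinD lee_fin !addr_ge0 ?lyapunov_ge0 ?utility_gap_ge0 ?noise_ge0.
  - by move=> s Ss; rewrite setTI; exact: le_integral_st_lyapunov.
rewrite ge0_integralD3//; last 3 first.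
- by move=> w _; rewrite lee_fin lyapunov_ge0.
- by move=> w _; rewrite lee_fin utility_gap_ge0.
- by move=> w _; rewrite lee_fin noise_ge0.
rewrite -addeA leeD2l// integral_cst//.
have PT : ((P : {measure set Omega -> \bar R}) setT = 1)%E.
  exact: probability_setT.
by rewrite PT mule1; exact: le_integral_noise.
Qed.

(** * Accumulated tosses, accumulated service and the final deficit *)

Definition served (k : nat) (l : L) (w : Omega) : R := (served_i Z sched k w l)%:R.

Lemma toss_le_served n l w :
  (\sum_(0 <= k < n) (toss Z k w l)%:R <=
   \sum_(0 <= k < n) served k l w + (st Z n w).1 l)%R.
Proof.
elim: n => [|n IH]; first by rewrite !big_nil add0r; have [] := S0 (SZ 0 w) l.
rewrite !big_nat_recr//= (hq n w l).1.
have : ((st Z n w).1 l + (toss Z n w l)%:R - served n l w <=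
  Num.max ((st Z n w).1 l + (toss Z n w l)%:R - (served_i Z sched n w l)%:R) 0)%R.
  by rewrite le_max lexx.
set m := Num.max _ _; lra.
Qed.

Lemma measurable_served k l D : measurable_fun D (fun w => (served k l w)%:E).
Proof.
exact: (@measurable_frame _ _ _ _ _ _ dZ cS SZ k
  (fun x => ((inelastic (sched x.1.1.1.2 x.1.1.2 x.1.1.1.1) l)%:R)%:E)).
Qed.

Lemma measurable_deficit k l D : measurable_fun D (fun w => ((st Z k w).1 l)%:E).
Proof.
exact: (discrete_measurable_fun (fun s : state R L => (s.1 l)%:E) (discrete_st dZ cS SZ k)).
Qed.

Lemma le_integral_served n l :
  (n%:R * (lambda N l * (1 - loss N l)))%:E <=
  \sum_(0 <= k < n) \int[P]_w (served k l w)%:E + \int[P]_w ((st Z n w).1 l)%:E.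
Proof.
have mt k : measurable_fun setT (fun w => ((toss Z k w l)%:R)%:E : \bar R).
  exact: (discrete_measurable_fun
    (fun u : pvec L => ((u l)%:R)%:E : \bar R) (discrete_toss dZ k)).
have ms k := @measurable_served k l setT.
have md := @measurable_deficit n l setT.
have d0 w : setT w -> 0 <= ((st Z n w).1 l)%:E.
  by move=> _; rewrite lee_fin; have [] := S0 (SZ n w) l.
have s0 k w : setT w -> 0 <= (served k l w)%:E by move=> _; rewrite lee_fin.
have t0 k w : setT w -> 0 <= ((toss Z k w l)%:R)%:E :> \bar R by move=> _; rewrite lee_fin.
have mS : measurable_fun setT (fun w => \sum_(0 <= k < n) (served k l w)%:E).
  exact: emeasurable_sum.
have S0' w : setT w -> 0 <= \sum_(0 <= k < n) (served k l w)%:E.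
  by move=> _; apply: sume_ge0 => k _; exact: s0.
rewrite -(ge0_integral_sum P measurableT ms s0) -(ge0_integralD P measurableT S0' mS d0 md).
apply: (@le_trans _ _ (\int[P]_w (\sum_(0 <= k < n) ((toss Z k w l)%:R)%:E))).
  rewrite (ge0_integral_sum P measurableT mt t0).
  under eq_bigr do rewrite (integral_toss dZ cS SZ ac ct loss01).
  by rewrite sumEFin sumr_const_nat subn0 mulr_natl.
apply: ge0_le_integral => //.
- by move=> w _; apply: sume_ge0 => k _; exact: t0.
- exact: emeasurable_sum.
- exact: emeasurable_funD.
- by move=> w _; rewrite !sumEFin -EFinD lee_fin toss_le_served.
Qed.

(** * Growth of the mean Lyapunov function and of the mean deficit *)

Context (v0 : R) (hv0 : \int[P]_w (lyapunov (st Z 0%N w))%:E = v0%:E).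

Lemma lyapunov_mean_le n :
  mean_le P (fun w => lyapunov (st Z n w)) (v0 + n%:R * step_bound)%R.
Proof.
split=> [|w|]; last 2 first.
- exact: lyapunov_ge0.
- elim: n => [|n IH]; first by rewrite hv0 mul0r addr0.
  apply: le_trans (le_integral_lyapunov n) _.
  rewrite -natr1 mulrDl mul1r addrA [leRHS]EFinD.
  exact: leeD.
- exact: (discrete_measurable_fun (fun s => (lyapunov s)%:E) (discrete_st dZ cS SZ n)).
Qed.

(** Young's inequality d <= g d^2 / 2 + 1 / (2g), with gap (g d - 1)^2 / (2g). The free [g] replaces
    a square root of the mean of V: a small [g] makes the part linear in the number of frames as
    small as desired. *)
Lemma deficit_le_lyapunov (s : state R L) l g : (0 < g)%R ->
  (s.1 l <= g * lyapunov s + (2 * g)^-1)%R.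
Proof.
move=> g0.
have dV : (2^-1 * s.1 l ^+ 2 <= lyapunov s)%R.
  rewrite /lyapunov ler_pM2l ?invr_gt0// (bigD1 l)//= -addrA lerDl addr_ge0 ?sqr_ge0//.
  by apply: sumr_ge0 => m _; rewrite addr_ge0 ?sqr_ge0.
apply: le_trans (lerD (ler_wpM2l (ltW g0) dV) (lexx _)).
rewrite -subr_ge0 (_ : (_ - _)%R = ((g * s.1 l - 1) ^+ 2 / (2 * g))%R).
  by rewrite divr_ge0 ?sqr_ge0 ?mulr_ge0// ltW.
by field; rewrite gt_eqF.
Qed.

Lemma le_integral_deficit n l g : (0 < g)%R ->
  \int[P]_w ((st Z n w).1 l)%:E <=
  (g * (v0 + n%:R * step_bound) + (2 * g)^-1)%:E.
Proof.
move=> g0; have c0 : (0 <= (2 * g)^-1)%R by rewrite invr_ge0 mulr_ge0// ltW.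
have PT : ((P : {measure set Omega -> \bar R}) setT = 1)%E.
  exact: probability_setT.
have cst_le : mean_le P (cst (2 * g)^-1%R) (2 * g)^-1%R.
  split=> //=.
  by rewrite (@integral_constant _ _ _ _ _ _ ((2 * g)^-1)%:E)// PT mule1.
have [mf f0 fle] := mean_leD (mean_leZ (ltW g0) (lyapunov_mean_le n)) cst_le.
apply: le_trans fle; apply: ge0_le_integral => //.
- by move=> w _; rewrite lee_fin; have [] := S0 (SZ n w) l.
- exact: measurable_deficit.
- by move=> w _; rewrite lee_fin; exact: deficit_le_lyapunov.
Qed.

End Drift.

(** * Passage to the lower limit *)

Lemma limn_einf_ge (R : realType) (u : nat -> \bar R) (x : R) :
  (forall e : R, 0 < e -> \forall n \near \oo, ((x - e)%:E <= u n)%E) ->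
  (x%:E <= limn_einf u)%E.
Proof.
move=> xu; apply/lee_subgt0Pr => e e0; rewrite limn_einf_lim.
apply: lime_ge; first exact: is_cvg_einfs.
have [m _ mu] := xu e e0; exists m => // n /= mn.
apply: le_ereal_inf_tmp => _ [k /= nk <-]; rewrite -EFinB.
by apply: mu => /=; exact: leq_trans nk.
Qed.

Theorem corollary2 (R : realType) (L : finType) (N : network R L)
    (z : static_point N)
    (eps Xmax sigma_e : R)
    (xt : state R L -> L -> R)
    (sched : pvec L -> pvec L -> state R L -> schedule L (slots N))
    (disp : measure_display) (Omega : measurableType disp)
    (P : probability Omega R) (Z : processes R L Omega)
    (S : set (state R L)) (K : state R L -> state R L -> R) :
  network_ok N ->
  static_solution z ->
  (forall l, lambda N l * (1 - loss N l) < mu_i z l) ->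
  (forall l, rate z l < mu_e z l) ->
  0 < eps ->
  (forall l, rate z l < Xmax) ->
  congestion_controller N eps Xmax xt ->
  scheduler eps sched ->
  discrete_variables Z ->
  arrivals_channels N P Z ->
  coin_tosses N P Z ->
  elastic_arrivals P Z sigma_e xt ->
  queue_updates Z sched ->
  (forall s, S s -> forall l, 0 <= s.1 l /\ 0 <= s.2 l) ->
  markov_chain P (st Z) S K ->
  irreducible S K ->
  aperiodic S K ->
  ('E_P[fun w => lyapunov (st Z 0%N w)] < +oo)%E ->
  forall l : L,
    ((lambda N l * (1 - loss N l))%:E <=
     limn_einf (fun n : nat =>
       'E_P[fun w => ((n%:R)^-1 *
              \sum_(0 <= k < n) (served_i Z sched k w l)%:R)%R]))%E.
Proof.
move=> [_ loss01 w0 _] [zF _] _ _ eps0 zX hxt hsched dZ ac ct ea hq S0 mc _ _ V0fin l.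
have cS := mc_countable mc.
have SZ := mc_in mc.
pose lam := lambda N l * (1 - loss N l).
pose B := step_bound eps Xmax sigma_e xt z.
have V0pos : (0 <= \int[P]_w (lyapunov (st Z 0%N w))%:E)%E.
  by apply: integral_ge0 => w _; rewrite lee_fin lyapunov_ge0.
pose v0 := fine (\int[P]_w (lyapunov (st Z 0%N w))%:E)%E.
have hv0 : (\int[P]_w (lyapunov (st Z 0%N w))%:E = v0%:E)%E.
  by rewrite fineK// ge0_fin_numE//; move: V0fin; rewrite expectation.unlock.
apply: limn_einf_ge => e e0.
(* A positive denominator that dominates [B] whatever its sign. *)
have B1 : 0 < 1 + `|B| by rewrite ltr_pwDl.
(* With this [g] the part of the bound on the mean deficit that is linear in
   [n] is at most [n * e / 2]. *)
pose g := e / (2 * (1 + `|B|)).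
have g0 : 0 < g by rewrite divr_gt0// mulr_gt0.
have gB : g * B <= e / 2.
  rewrite (_ : g * B = e / 2 * (B / (1 + `|B|))); last first.
    by rewrite /g; field; rewrite gt_eqF.
  rewrite ler_piMr ?(divr_ge0 (ltW e0))// ler_pdivrMr// mul1r.
  by have := ler_norm B; lra.
(* The 1 keeps [n] positive; the other bound absorbs the part of the deficit estimate that is
   constant in [n] into [n * e / 2]. *)
pose M := Num.max 1 (2 / e * (g * v0 + (2 * g)^-1)).
have near_M := nbhs_infty_ger M.
near=> n.
have Mn : M <= n%:R by near: n; exact: near_M.
have n0 : 0 < n%:R :> R.
  by apply: lt_le_trans Mn; rewrite lt_max ltr01.
have vn : g * v0 + (2 * g)^-1 <= n%:R * (e / 2).
  have : 2 / e * (g * v0 + (2 * g)^-1) <= n%:R.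
    by apply: le_trans Mn; rewrite le_max lexx orbT.
  move/(ler_wpM2l (divr_ge0 (ltW e0) (ler0n _ 2))).
  rewrite [leRHS]mulrC; apply: le_trans; rewrite le_eqVlt; apply/orP; left.
  by apply/eqP; field; rewrite !gt_eqF.
have served0 k w : (0 <= (served Z sched k l w)%:E)%E by rewrite lee_fin.
have ms k := @measurable_served _ _ _ _ _ _ _ dZ cS SZ sched k l setT.
have -> : ('E_P[fun w => (n%:R^-1 * \sum_(0 <= k < n) (served_i Z sched k w l)%:R)%R] =
    (n%:R^-1)%:E * \sum_(0 <= k < n) \int[P]_w (served Z sched k l w)%:E)%E.
  have mS : measurable_fun setT (fun w => (\sum_(0 <= k < n) (served Z sched k l w)%:E)%E).
    exact: emeasurable_sum.
  have sum0 w : setT w -> (0 <= \sum_(0 <= k < n) (served Z sched k l w)%:E)%E.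
    by move=> _; apply: sume_ge0.
  have n_inv0 : 0 <= n%:R^-1 :> R by rewrite invr_ge0 ltW.
  rewrite expectation.unlock -(ge0_integral_sum P measurableT ms)//.
  rewrite -(ge0_integralZl_EFin P measurableT sum0 mS n_inv0).
  by apply: eq_integral => w _; rewrite sumEFin -EFinM.
rewrite lee_pdivlMl//.
have := le_integral_served dZ cS SZ S0 ac ct loss01 hq n l.
have := le_integral_deficit dZ cS SZ S0 ac ct loss01 w0 eps0 hxt ea hsched hq zF zX hv0 n l g0.
(* The mean deficit is replaced by its real bound before it is moved across, as the transposition in
   the extended reals needs a finite term. *)
move=> dle /le_trans/(_ (leeD2l _ dle)).
rewrite -leeBlDr//; apply: le_trans.
rewrite -EFinM -EFinB lee_fin -/lam -/B.
have := ler_wpM2l (ltW n0) gB.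
lra.
Unshelve. all: by end_near.
Qed.
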